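(* Let $\Omega$ be a compact metric space and let $K$ be a kernel on $\Omega\times\Omega$. Suppose that there exists a measure $\mu\in\mathbb P(\Omega)$ which is $K$-invariant, i.e. $U_K^\mu(x)=I_K(\mu)$ for all $x\in\Omega$. Then the following conditions are equivalent: (1) $K$ is conditionally strictly positive definite. (2) $K$ is strictly positive definite modulo an additive constant. (3) $\mu$ is the unique minimizer of $I_K$ over $\widetilde{\mathbb P}(\Omega)$. (4) $I_K$ is strictly convex on $\mathbb P(\Omega)$ (or, equivalently, on $\widetilde{\mathbb P}(\Omega)$). If in addition $\operatorname{supp}(\mu)=\Omega$, then each of the conditions (1)--(3) implies the following: (5) The kernel $K$ can be represented as $$K(x,y)=\sum_{j=1}^{\dim(L^2(\Omega,\mu))}\lambda_j\phi_j(x)\phi_j(y),$$ where $\{\phi_j\}$ is the orthonormal basis of $L^2(\Omega,\mu)$ consisting of eigenfunctions of the operator $T_{K,\mu}$ (with eigenvalues $\lambda_j$), the function $\phi_1$ is a constant, the series converges uniformly and absolutely, and $\lambda_j>0$ for $j\ge2$. Moreover (still assuming $\operatorname{supp}(\mu)=\Omega$), if the span of $\{\phi_j\}$ is dense in $C(\Omega)$, then (5) also implies conditions (1)--(3).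
   Context: A kernel on $\Omega\times\Omega$ is a continuous symmetric function $K:\Omega\times\Omega\to\mathbb R$. $\mathcal M(\Omega)$ is the set of finite regular signed Borel measures on $\Omega$; $\mathbb P(\Omega)$ the Borel probability measures; $\widetilde{\mathbb P}(\Omega)$ the set of $\nu\in\mathcal M(\Omega)$ with $\nu(\Omega)=1$; $\mathcal Z(\Omega)$ the set of $\nu\in\mathcal M(\Omega)$ with $\nu(\Omega)=0$. $I_K(\mu)=\int_\Omega\int_\Omega K(x,y)\,d\mu(x)\,d\mu(y)$ and $U_K^\mu(x)=\int_\Omega K(x,y)\,d\mu(y)$. $K$ is positive definite (resp. conditionally positive definite) if $I_K(\nu)\ge0$ for every $\nu\in\mathcal M(\Omega)$ (resp. every $\nu\in\mathcal Z(\Omega)$). It is strictly positive definite (resp. conditionally strictly positive definite) if in addition, for $\nu$ in the respective class, $I_K(\nu)=0$ only if $\nu=0$. $K$ is strictly positive definite modulo an additive constant if $K+C$ is strictly positive definite for some $C\in\mathbb R$. $I_K$ is strictly convex on $\mathbb P(\Omega)$ (resp. $\widetilde{\mathbb P}(\Omega)$) if for all $\mu_1,\mu_2$ in that set, $I_K((1-t)\mu_1+t\mu_2)\le(1-t)I_K(\mu_1)+tI_K(\mu_2)$ for all $t\in[0,1]$, with strict inequality for all $t\in(0,1)$ unless $\mu_1=\mu_2$. $T_{K,\mu}$ is the (self-adjoint, Hilbert--Schmidt) operator on the real space $L^2(\Omega,\mu)$ given by $T_{K,\mu}\psi(x)=\int_\Omega K(x,y)\psi(y)\,d\mu(y)$.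 Eigenfunctions with nonzero eigenvalue are identified with their continuous representatives. $C(\Omega)$ carries the uniform norm. $\dim(L^2(\Omega,\mu))$ may be infinite. *)

(* Defs.v *)
From HB Require Import structures.
From mathcomp Require Import all_boot all_order all_algebra.
From mathcomp Require Import all_classical all_reals all_analysis.

Set Implicit Arguments.
Unset Strict Implicit.
Unset Printing Implicit Defensive.

Import Order.TTheory GRing.Theory Num.Theory.
Import numFieldNormedType.Exports.

Local Open Scope classical_set_scope.
Local Open Scope ring_scope.

(* A [measurableType] is pointed, hence so are the metric spaces considered
   here; this only rules out the empty space, which carries no probability. *)
#[short(type="pointedMetricType")]
HB.structure Definition PointedMetric (R : numDomainType) :=
  {T of Pointed T & Metric R T}.

Notation borel T := (g_sigma_algebraType (@open T)).

Section signed_measures.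
Context {R : realType} {T : pointedMetricType R}.
Local Notation signed := (charge (borel T) R).
Implicit Types (nu : signed) (f : T -> R).

Lemma Hahn_pair nu :
  exists PN : set (borel T) * set (borel T), hahn_decomposition nu PN.1 PN.2.
Proof. by have [P [N PN]] := Hahn_decomposition nu; exists (P, N). Qed.

(* The integral and the total variation below do not depend on the chosen Hahn
   decomposition. *)
Definition hahn nu := svalP (cid (Hahn_pair nu)).

Definition cintegral nu f : R :=
  \int[jordan_pos (hahn nu)]_x f x - \int[jordan_neg (hahn nu)]_x f x.

Definition total_variation nu : set (borel T) -> \bar R :=
  charge_variation (hahn nu).

Definition regular nu := forall A : set (borel T), measurable A ->
  total_variation nu A =
    ereal_inf [set total_variation nu U | U in [set U | @open T U /\ A `<=` U]]
  /\ total_variation nu A =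
    ereal_sup [set total_variation nu F | F in [set F | @compact T F /\ F `<=` A]].

(* Charges are functions on all sets, but only their values on Borel sets are
   meaningful. *)
Definition eq_charge nu1 nu2 :=
  forall A : set (borel T), measurable A -> nu1 A = nu2 A.

Definition signed_measures : set signed := [set nu | regular nu].

Definition prob_measures : set signed :=
  range (fun P : probability (borel T) R => charge_of_finite_measure P : signed).

Definition signed_prob_measures : set signed :=
  [set nu | signed_measures nu /\ nu setT = 1%E].

Definition neutral_measures : set signed :=
  [set nu | signed_measures nu /\ nu setT = 0%E].

Definition mixture (t : R) nu1 nu2 : signed :=
  cadd (cscale (1 - t) nu1) (cscale t nu2).

Definition measure_support (mu : probability (borel T) R) : set T :=
  [set x | forall U : set T, open U -> U x -> (0 < mu U)%E].

End signed_measures.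

Section kernels.
Context {R : realType} {T : pointedMetricType R}.
Local Notation signed := (charge (borel T) R).
Implicit Types (K : T -> T -> R) (nu : signed) (S : set signed).

Definition is_kernel K :=
  continuous (fun p : T * T => K p.1 p.2) /\ forall x y, K x y = K y x.

Definition energy K nu : R := cintegral nu (fun y => cintegral nu (fun x => K x y)).

Definition potential K nu (x : T) : R := cintegral nu (fun y => K x y).

Definition energy_ge0_on S K := forall nu, S nu -> 0 <= energy K nu.

Definition energy_definite_on S K :=
  energy_ge0_on S K /\
  forall nu, S nu -> energy K nu = 0 -> eq_charge nu czero.

Definition strictly_positive_definite K := energy_definite_on signed_measures K.

Definition cond_strictly_positive_definite K :=
  energy_definite_on neutral_measures K.

Definition strictly_positive_definite_mod_cst K :=
  exists C : R, strictly_positive_definite (fun x y => K x y + C).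

Definition is_minimizer K S nu :=
  S nu /\ forall nu', S nu' -> energy K nu <= energy K nu'.

Definition is_unique_minimizer K S nu :=
  is_minimizer K S nu /\ forall nu', is_minimizer K S nu' -> eq_charge nu' nu.

Definition strictly_convex_energy_on S K := forall nu1 nu2, S nu1 -> S nu2 ->
  (forall t, 0 <= t <= 1 ->
     energy K (mixture t nu1 nu2) <= (1 - t) * energy K nu1 + t * energy K nu2) /\
  (~ eq_charge nu1 nu2 -> forall t, 0 < t < 1 ->
     energy K (mixture t nu1 nu2) < (1 - t) * energy K nu1 + t * energy K nu2).

End kernels.

Section eigenexpansion.
Context {R : realType} {T : pointedMetricType R}.
Variables (K : T -> T -> R) (mu : probability (borel T) R).
Implicit Types (D : set nat) (lambda : nat -> R) (phi : nat -> T -> R).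

Definition kernel_operator (psi : T -> R) (x : T) : R :=
  \int[mu]_y (K x y * psi y).

Definition linear_span D phi : set (T -> R) :=
  [set g | exists n (c : nat -> R),
     g = fun x => \sum_(j < n | (j : nat) \in D) c j * phi j x].

(* A family is indexed by an initial segment D of nat, either {0, .., n - 1} or
   nat itself. For an orthonormal basis, D stands for {j | j < dim L^2(mu)}. *)
Record is_orthonormal_basis D phi : Prop := {
  onb_index : forall i j, (i <= j)%N -> D j -> D i ;
  onb_L2 : forall j, D j -> (phi j : borel T -> R) \in Lfun mu 2%:E ;
  onb_orthonormal : forall i j, D i -> D j ->
    \int[mu]_x (phi i x * phi j x) = (i == j)%:R ;
  onb_dense : forall f : borel T -> R, f \in Lfun mu 2%:E ->
    forall e : R, 0 < e -> exists2 g, linear_span D phi g &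
      ('N[mu]_2%:E[EFin \o (f \- g)%R] < e%:E)%E }.

(* Eigenfunctions are classes modulo mu-a.e. equality; those with a nonzero
   eigenvalue are represented by continuous functions, and the first one, whose
   eigenvalue may vanish, by a constant function. Indices are shifted by one. *)
Record is_eigenexpansion D lambda phi : Prop := {
  exp_basis : is_orthonormal_basis D phi ;
  exp_eigen : forall j, D j ->
    {ae mu, forall x, kernel_operator (phi j) x = lambda j * phi j x} ;
  exp_continuous : forall j, D j -> lambda j != 0 -> continuous (phi j) ;
  exp_cst : exists c : R, forall x, phi 0%N x = c ;
  exp_gt0 : forall j, D j -> (0 < j)%N -> 0 < lambda j ;
  exp_uniform : {uniform [set: T * T],
    (fun n (p : T * T) =>
       \sum_(j < n | (j : nat) \in D) lambda j * phi j p.1 * phi j p.2) @ \oo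
    --> (fun p => K p.1 p.2)} ;
  exp_absolute : forall x y,
    summable D (fun j => (lambda j * phi j x * phi j y)%:E) }.

Definition has_eigenexpansion := exists D lambda phi, is_eigenexpansion D lambda phi.

Definition dense_in_continuous (G : set (T -> R)) :=
  forall f : T -> R, continuous f -> forall e : R, 0 < e ->
  exists2 g, G g & forall x, `|f x - g x| < e.

End eigenexpansion.

(* Main.v *)
Require Import Defs.
From HB Require Import structures.
From mathcomp Require Import all_boot all_order all_algebra.
From mathcomp Require Import all_classical all_reals all_analysis.
From mathcomp Require Import measurable_realfun ring lra.

(** Write m for the invariant measure. Its potential is constant, so m is
    orthogonal, for the energy form, to every neutral charge: for a charge nu
    of mass a, I(nu - a m) = I(nu) - a^2 I(m) ([energy_project]). Conditional
    strict positivity makes the energy of K + 1 - I(m), which is I(nu - a m) +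
    a^2, strictly positive, and on charges of mass one I(nu) - I(m) = I(nu -
    m) says that m is the unique minimizer. Along a segment, the convexity
    defect of I is t (1 - t) times the energy of the difference of the
    endpoints ([strictly_convexP]), and every neutral charge is a multiple of
    a difference of two probabilities ([neutral_jordan]); this gives the
    statements on convexity. All of it is algebra of the bilinear energy form,
    whose symmetry is Fubini's theorem for a continuous kernel
    ([bounded_linear_exchange]).

    For the eigenexpansion, the kernel K0 = K - I(m) is positive definite on
    all charges and its operator kills the constants. Its eigenfunctions are
    split off one at a time. The largest eigenvalue is attained by Ascoli's
    theorem ([top_eigenfunction]), and subtracting its rank-one term leaves a
    kernel that is still positive on every charge ([deflate_psd]). The trace
    bounds the n-th eigenvalue by O(1/n) ([eigval_le]). Positivity on
    differences of two point masses makes the residual kernels equicontinuous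
    ([residual_equicontinuous]); their operators tend to 0 when applied to
    bump functions, and averaging over a small ball, which has positive mass
    because m has full support, shows that the residual kernels tend to 0
    uniformly ([residual_cvg]). This is Mercer's theorem for K0, and adding
    the constant I(m) gives the expansion of K.

    The eigenfunctions form a basis of L^2 because a function h orthogonal to
    all of them, constants included, is annihilated by the operator of K0. The
    charge h m then has zero energy for K0, and strict definiteness makes it a
    multiple of m; so h is constant, and zero because it is orthogonal to the
    constants ([expansion_total]); completeness of L^2 turns this into density
    of the span ([riesz_fischer], [total_orthonormal_dense]).

    Conversely, an expansion gives I(nu) as the sum of the lambda_j times the
    squares of the integrals of phi_j against nu, and the constant phi_0 does
    not contribute when nu is neutral. If I(nu) = 0 then nu annihilates the
    span of the phi_j, hence all continuous functions when the span is dense,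
    hence vanishes by regularity ([dense_cond_strictly], [charge_eq0]). *)

Set Implicit Arguments.
Unset Strict Implicit.
Unset Printing Implicit Defensive.

Import Order.TTheory GRing.Theory Num.Theory.
Import numFieldNormedType.Exports.

Local Open Scope classical_set_scope.
Local Open Scope ring_scope.

(** * Bounded functionals and integration against a charge *)

Section bounded_linear_functionals.
Context {T : Type} {R : realType}.
Implicit Types (f g : T -> R) (S : set (T -> R)) (L : (T -> R) -> R).

Definition bounded_linear S L := [/\
  forall f g, S f -> S g -> L (fun x => f x + g x) = L f + L g,
  forall a f, S f -> L (fun x => a * f x) = a * L f &
  exists2 C : R, 0 <= C &
    forall f (M : R), S f -> (forall x, `|f x| <= M) -> `|L f| <= C * M].

Lemma bounded_linearB S L f g : bounded_linear S L ->
  S f -> S g -> S (fun x => -1 * g x) ->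
  L (fun x => f x - g x) = L f - L g.
Proof.
move=> [LD LZ _] Sf Sg Sg'.
rewrite (_ : (fun x => _) = (fun x => f x + -1 * g x)).
  by rewrite LD// LZ// mulN1r.
by apply/funext => x; rewrite mulN1r.
Qed.

Lemma bounded_linear_sum S L n (F : nat -> T -> R) : bounded_linear S L ->
  S (fun=> 0) -> (forall f g, S f -> S g -> S (fun x => f x + g x)) ->
  (forall i, S (F i)) ->
  L (fun x => \sum_(i < n) F i x) = \sum_(i < n) L (F i).
Proof.
move=> [LD LZ _] S0 SD SF.
suff [//] : S (fun x => \sum_(i < n) F i x) /\
  L (fun x => \sum_(i < n) F i x) = \sum_(i < n) L (F i).
elim: n => [|n [IS IH]].
  have -> : (fun x => \sum_(i < 0) F i x) = (fun x : T => 0 * 0).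
    by apply/funext => x; rewrite big_ord0 mul0r.
  by split; [rewrite mul0r|rewrite (LZ _ (fun=> 0))// big_ord0 mul0r].
under eq_fun do rewrite big_ord_recr/=.
by split; [exact: SD|rewrite LD// big_ord_recr/= IH].
Qed.

(** The estimate |L1 f - L2 f| <= (C1 + C2) sup |f - g|, with one g for each
    precision. *)
Lemma bounded_linear_close S L1 L2 f : bounded_linear S L1 ->
  bounded_linear S L2 -> S f ->
  (forall e, 0 < e -> exists g, [/\ S g, S (fun x => -1 * g x),
     S (fun x => f x - g x), L1 g = L2 g & forall x, `|f x - g x| <= e]) ->
  L1 f = L2 f.
Proof.
move=> B1 B2 Sf app; apply/eqP; rewrite -subr_eq0 -normr_le0.
have [_ _ [C1 C10 L1C]] := B1; have [_ _ [C2 C20 L2C]] := B2.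
apply/ler_addgt0Pl => e e0; rewrite addr0; pose e' := e / (C1 + C2 + 1).
have e'0 : 0 < e' by rewrite divr_gt0//; lra.
have [g [Sg Sg' Sfg Lg fg]] := app _ e'0.
have eE : e = C1 * e' + C2 * e' + e' by rewrite /e'; field; lra.
have := L2C _ _ Sfg fg; have := L1C _ _ Sfg fg.
rewrite (bounded_linearB B1)// (bounded_linearB B2)// Lg => h1 h2.
have := ler_distD (L2 g) (L1 f) (L2 f); rewrite (distrC (L2 g)); lra.
Qed.

End bounded_linear_functionals.

Section bounded_functionals.
Context d {T : measurableType d} {R : realType}.
Implicit Types (f g : T -> R) (L : (T -> R) -> R).

Definition bounded_measurable f :=
  measurable_fun [set: T] f /\ exists M : R, forall x, `|f x| <= M.

(** The sum counts the multiples of e below t: it rounds t down to such a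
    multiple. *)
Lemma staircase_approx (e t : R) n : 0 < e -> 0 <= t <= n%:R * e ->
  0 <= t - \sum_(i < n) e * (i.+1%:R * e <= t)%R%:R <= e.
Proof.
move=> e0; elim: n => [|n IH] /andP[t0 tn].
  by rewrite big_ord0 subr0; apply/andP; split=> //; rewrite mul0r in tn; lra.
rewrite big_ord_recr/=; have [tle|tgt] := leP t (n%:R * e).
  have -> : (n.+1%:R * e <= t) = false.
    apply/negbTE; rewrite -ltNge (le_lt_trans tle)// ltr_pM2r// ltr_nat//.
  by rewrite mulr0 addr0 IH// t0.
rewrite (eq_bigr (fun=> e)) => [|i _]; last first.
  rewrite (_ : _ <= t = true) ?mulr1//.
  by rewrite (le_trans _ (ltW tgt))// ler_pM2r// ler_nat.
rewrite sumr_const card_ord -[e *+ n]mulr_natl.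
move: tn; rewrite -natr1 mulrDl mul1r => tn.
by case: (leP _ t) => /= h; rewrite ?mulr1 ?mulr0; apply/andP; split; lra.
Qed.

Lemma bounded_measurable_approx f (e : R) : bounded_measurable f -> 0 < e ->
  exists n (c : nat -> R) (A : nat -> set T), (forall i, measurable (A i)) /\
  forall x, `|f x - \sum_(i < n) c i * \1_(A i) x| <= e.
Proof.
move=> [mf [M fM]] e0.
have M0 : 0 <= M by apply: le_trans (fM point).
pose n := Num.bound (2 * M / e).
have Mn : 2 * M <= n%:R * e.
  by rewrite -ler_pdivrMr//; apply/ltW/archi_boundP/divr_ge0; lra.
(* The first term is the constant -M; the others are the steps of f + M, which
   takes its values in [0, 2M]. *)
pose A i := if i is i'.+1 then [set x | i'.+1%:R * e <= f x + M] else setT.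
exists n.+1, (fun i => if i is 0 then - M else e), A; split.
  case=> [|i] /=; first exact: measurableT.
  rewrite -[X in measurable X]setTI.
  have -> : [set x | i.+1%:R * e <= f x + M] =
            f @^-1` [set` `[i.+1%:R * e - M, +oo[].
    by apply/seteqP; split=> x /=; rewrite in_itv/= andbT lerBlDr.
  exact: mf.
move=> x; rewrite big_ord_recl/= indicE in_setT mulr1.
have /andP[fl fu] : - M <= f x <= M by rewrite -ler_norml.
have := @staircase_approx e (f x + M) n e0 _.
have -> : \sum_(i < n) e * (i.+1%:R * e <= f x + M)%R%:R =
          \sum_(i < n) e * \1_(A i.+1) x.
  apply: eq_bigr => i _; rewrite indicE /A/=.
  congr (_ * _%:R); congr nat_of_bool.
  by apply/idP/idP => [h|/set_mem//]; exact/mem_set.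
rewrite /bump/= => /(_ _)/andP[|h1 h2]; first by apply/andP; split; lra.
by rewrite ler_norml; apply/andP; split; lra.
Qed.

Lemma bounded_measurable_indic (A : set T) : measurable A ->
  bounded_measurable (\1_A : T -> R).
Proof.
move=> mA; split; first exact: measurable_indic.
by exists 1 => x; rewrite indicE; case: (_ \in _); rewrite /= ?normr1 ?normr0.
Qed.

Lemma bounded_measurableD f g : bounded_measurable f -> bounded_measurable g ->
  bounded_measurable (fun x => f x + g x).
Proof.
move=> [mf [M fM]] [mg [N gN]]; split; first exact: measurable_funD.
by exists (M + N) => x; rewrite (le_trans (ler_normD _ _))// lerD.
Qed.

Lemma bounded_measurableZ a f : bounded_measurable f ->
  bounded_measurable (fun x => a * f x).
Proof.
move=> [mf [M fM]]; split; first exact: measurable_funM.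
by exists (`|a| * M) => x; rewrite normrM ler_wpM2l.
Qed.

Lemma bounded_measurable_cst a : bounded_measurable (fun=> a).
Proof. by split; [exact: measurable_cst|exists `|a|]. Qed.

Lemma bounded_measurable_sum n (F : nat -> T -> R) :
  (forall i, bounded_measurable (F i)) ->
  bounded_measurable (fun x => \sum_(i < n) F i x).
Proof.
move=> bF; elim: n => [|n IH].
  by under eq_fun do rewrite big_ord0; exact: bounded_measurable_cst.
by under eq_fun do rewrite big_ord_recr/=; exact: bounded_measurableD.
Qed.

(** Layer-cake sums of indicators approximate a bounded measurable function
    uniformly, so a functional that is continuous for uniform convergence is
    known once it is known on indicators. *)
Lemma bounded_linear_unique L1 L2 : bounded_linear bounded_measurable L1 ->
  bounded_linear bounded_measurable L2 ->
  (forall A, measurable A -> L1 \1_A = L2 \1_A) ->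
  forall f, bounded_measurable f -> L1 f = L2 f.
Proof.
move=> B1 B2 L12 f bf; apply: (bounded_linear_close B1 B2 bf) => e e0.
have [n [c [A [mA fA]]]] := bounded_measurable_approx bf e0.
have bA i : bounded_measurable (fun x => c i * \1_(A i) x).
  exact/bounded_measurableZ/bounded_measurable_indic.
have bs := bounded_measurable_sum n bA.
exists (fun x => \sum_(i < n) c i * \1_(A i) x); split => //.
- exact: bounded_measurableZ.
- under eq_fun do rewrite -mulN1r.
  exact/bounded_measurableD/bounded_measurableZ.
- have b0 := bounded_measurable_cst 0; have bD := bounded_measurableD.
  pose F i x := c i * \1_(A i) x.
  rewrite (bounded_linear_sum (F := F) n B1)//.
  rewrite (bounded_linear_sum (F := F) n B2)//.
  apply: eq_bigr => i _.
  have [_ LZ1 _] := B1; have [_ LZ2 _] := B2.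
  have ? := bounded_measurable_indic (mA i).
  by rewrite (LZ1 _ \1_(A i))// (LZ2 _ \1_(A i))// L12.
Qed.

Lemma bounded_measurable_integrable (m : {finite_measure set T -> \bar R}) f :
  bounded_measurable f -> m.-integrable [set: T] (EFin \o f).
Proof.
move=> [mf [M fM]]; apply: measurable_bounded_integrable => //.
  by rewrite ltey_eq fin_num_measure.
exists M; split; first exact: num_real.
by move=> y My x _ /=; rewrite (le_trans (fM x))// ltW.
Qed.

Lemma bounded_linear_Rintegral (m : {finite_measure set T -> \bar R}) :
  bounded_linear bounded_measurable (fun f => \int[m]_x f x).
Proof.
have bi := bounded_measurable_integrable.
split=> [f g bf bg|a f bf|]; first by rewrite RintegralD//; exact: bi.
  by rewrite RintegralZl//; exact: bi.
exists (fine (m setT)) => [|f M bf fM]; first by rewrite fine_ge0.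
rewrite (le_trans (le_normr_Rintegral _ _))//; first exact: bi.
rewrite mulrC -Rintegral_cst//; apply: le_Rintegral => //.
- apply: (bi m (fun x => `|f x|)); case: bf => mf [N fN]; split.
    exact: measurableT_comp.
  by exists N => x; rewrite normr_id.
- exact: (bi m (fun=> M) (bounded_measurable_cst M)).
Qed.

Lemma Rintegral_indic (m : {finite_measure set T -> \bar R}) (A : set T) :
  measurable A -> \int[m]_x \1_A x = fine (m A).
Proof. by move=> mA; rewrite /Rintegral integral_indic// setIT. Qed.

End bounded_functionals.

Section cintegral_theory.
Context {R : realType} {T : pointedMetricType R}.
Local Notation signed := (charge (borel T) R).
Implicit Types (nu : signed) (f : borel T -> R).

Local Notation bm := (@bounded_measurable _ (borel T) R).

Lemma bounded_linear_cintegral nu : bounded_linear bm (cintegral nu).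
Proof.
have [PD PZ [C C0 PC]] := bounded_linear_Rintegral (jordan_pos (hahn nu)).
have [ND NZ [C' C'0 NC]] := bounded_linear_Rintegral (jordan_neg (hahn nu)).
split=> [f g bf bg|a f bf|]; rewrite /cintegral.
- by rewrite PD// ND// addrACA opprD.
- by rewrite PZ// NZ// mulrBr.
- exists (C + C') => [|f M bf fM]; first exact: addr_ge0.
  by rewrite (le_trans (ler_normB _ _))// mulrDl lerD ?PC ?NC.
Qed.

Lemma jordan_decompB nu (A : set (borel T)) : measurable A ->
  nu A = (jordan_pos (hahn nu) A - jordan_neg (hahn nu) A)%E.
Proof.
move=> mA; rewrite [LHS](jordan_decomp (hahn nu) mA) /cadd/= /cscale.
by rewrite EFinN mulN1e.
Qed.

Lemma cintegral_indic nu (A : set (borel T)) : measurable A ->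
  cintegral nu \1_A = fine (nu A).
Proof.
move=> mA; rewrite /cintegral !Rintegral_indic//.
rewrite jordan_decompB// fineD ?fineN// ?fin_numN; exact: fin_num_measure.
Qed.

(** The Hahn decompositions of two charges and of their sum are unrelated, so
    linearity in the charge is not read off the definition; it follows from this
    characterization by the values on indicators. *)
Lemma cintegral_unique nu (L : (borel T -> R) -> R) : bounded_linear bm L ->
  (forall A, measurable A -> L \1_A = fine (nu A)) ->
  forall f, bm f -> cintegral nu f = L f.
Proof.
move=> BL LA; apply: bounded_linear_unique (bounded_linear_cintegral nu) BL _.
by move=> A mA; rewrite LA// cintegral_indic.
Qed.

Lemma cintegralD nu1 nu2 f : bm f ->
  cintegral (cadd nu1 nu2) f = cintegral nu1 f + cintegral nu2 f.
Proof.
have [D1 Z1 [C1 C10 B1]] := bounded_linear_cintegral nu1.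
have [D2 Z2 [C2 C20 B2]] := bounded_linear_cintegral nu2.
apply: (cintegral_unique (L := fun f => cintegral nu1 f + cintegral nu2 f)).
  split=> [g h bg bh|a g bg|]; first by rewrite D1// D2// addrACA.
    by rewrite Z1// Z2// -mulrDr.
  exists (C1 + C2) => [|g M bg gM]; first exact: addr_ge0.
  by rewrite (le_trans (ler_normD _ _))// mulrDl lerD ?B1 ?B2.
move=> A mA; rewrite !cintegral_indic// /cadd/=.
by rewrite fineD//; exact: fin_num_measure.
Qed.

Lemma cintegralZ nu a f : bm f -> cintegral (cscale a nu) f = a * cintegral nu f.
Proof.
have [D1 Z1 [C1 C10 B1]] := bounded_linear_cintegral nu.
apply: (cintegral_unique (L := fun f => a * cintegral nu f)).
  split=> [g h bg bh|b g bg|]; first by rewrite D1// -mulrDr.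
    by rewrite Z1// mulrCA.
  exists (`|a| * C1) => [|g M bg gM]; first exact: mulr_ge0.
  by rewrite normrM -mulrA ler_wpM2l// B1.
move=> A mA; rewrite !cintegral_indic// /cscale/=.
by rewrite fineM//; exact: fin_num_measure.
Qed.

Lemma eq_cintegral nu1 nu2 f : eq_charge nu1 nu2 -> bm f ->
  cintegral nu1 f = cintegral nu2 f.
Proof.
move=> nu12; apply: cintegral_unique (bounded_linear_cintegral nu2) _ _.
by move=> A mA; rewrite cintegral_indic// nu12.
Qed.

Lemma cintegral_finite_measure (m : {finite_measure set (borel T) -> \bar R}) f :
  bm f -> cintegral (charge_of_finite_measure m) f = \int[m]_x f x.
Proof.
apply: cintegral_unique (bounded_linear_Rintegral m) _ _ => A mA.
exact: Rintegral_indic.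
Qed.

Lemma integrable_bounded_mul (m : {measure set (borel T) -> \bar R}) f h :
  bm f -> m.-integrable [set: borel T] (EFin \o h) ->
  m.-integrable [set: borel T] (EFin \o (fun x => f x * h x)).
Proof.
move=> [mf [M fM]] ih.
have mh : measurable_fun setT h by apply/measurable_EFinP; exact: measurable_int ih.
have := integrableZl measurableT `|M| (integrable_abse ih).
apply: le_integrable => //=.
  by apply/measurable_EFinP; exact: measurable_funM.
move=> x _ /=; rewrite lee_fin !normrM !normr_id ler_wpM2r//.
exact: le_trans (fM x) (ler_norm _).
Qed.

Lemma cintegral_density (m : {finite_measure set (borel T) -> \bar R})
    (h : borel T -> R) (ih : m.-integrable [set: borel T] (EFin \o h)) f :
  bm f -> cintegral (induced_charge ih) f = \int[m]_x (f x * h x).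
Proof.
apply: (cintegral_unique (nu := induced_charge ih)
  (L := fun f => \int[m]_x (f x * h x))).
  have ib g : bm g -> m.-integrable setT (EFin \o (fun x => g x * h x)).
    by move=> bg; exact: integrable_bounded_mul.
  have ia : m.-integrable setT (EFin \o (fun x => `|h x|)).
    exact: (integrable_abse ih).
  split=> [f1 f2 b1 b2|a f1 b1|].
  - under eq_Rintegral do rewrite mulrDl.
    by rewrite RintegralD//; exact: ib.
  - under eq_Rintegral do rewrite -mulrA.
    by rewrite RintegralZl//; exact: ib.
  - exists (\int[m]_x `|h x|) => [|g M bg gM]; first exact: Rintegral_ge0.
    rewrite (le_trans (le_normr_Rintegral _ _))//; first exact: ib.
    rewrite mulrC -RintegralZl//; apply: le_Rintegral => //.
    + exact: (integrable_abse (ib _ bg)).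
    + exact: (integrableZl measurableT M ia).
    + by move=> x _; rewrite normrM ler_wpM2r.
move=> A mA; rewrite /Rintegral -[RHS]/(fine (\int[m]_(x in A) (h x)%:E)%E).
rewrite [in RHS]integral_mkcond; congr fine; apply: eq_integral => x _.
by rewrite patchE indicE; case: (x \in A); rewrite ?mul1r ?mul0r.
Qed.

End cintegral_theory.

(** * Continuous functions on a compact metric space *)

Section metric_continuity.
Context {R : realType} {T : pointedMetricType R}.
Implicit Types (f g : T -> R) (x y z : T).

Lemma continuous_ballP f : continuous f <->
  forall x (e : R), 0 < e -> exists2 d : R, 0 < d &
    forall y, ball x d y -> `|f x - f y| < e.
Proof.
split=> [cf x e e0|H x].
  have /cvgrPdist_lt/(_ _ e0)/nbhs_ballP[d d0 dP] := cf x.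
  by exists d => // y /dP.
apply/cvgrPdist_lt => e e0; have [d d0 dP] := H x e e0.
by apply/nbhs_ballP; exists d => // y /dP.
Qed.

Lemma continuous_cst (a : R) : continuous (fun _ : T => a).
Proof. by move=> x; exact: cvg_cst. Qed.

Lemma continuousDf f g : continuous f -> continuous g ->
  continuous (fun x => f x + g x).
Proof. by move=> cf cg x; apply: cvgD; [exact: cf|exact: cg]. Qed.

Lemma continuousMf f g : continuous f -> continuous g ->
  continuous (fun x => f x * g x).
Proof. by move=> cf cg x; apply: cvgM; [exact: cf|exact: cg]. Qed.

Lemma continuousZf (a : R) f : continuous f -> continuous (fun x => a * f x).
Proof. by apply: continuousMf => x; exact: cvg_cst. Qed.

Lemma continuousBf f g : continuous f -> continuous g ->
  continuous (fun x => f x - g x).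
Proof. by move=> cf cg x; apply: cvgB; [exact: cf|exact: cg]. Qed.

Lemma continuous_sum n (F : nat -> T -> R) : (forall i, continuous (F i)) ->
  continuous (fun x => \sum_(i < n) F i x).
Proof.
move=> cF; elim: n => [|n IH].
  by under eq_fun do rewrite big_ord0; exact: continuous_cst.
by under eq_fun do rewrite big_ord_recr/=; exact: continuousDf.
Qed.

Definition bump z (d : R) x : R := Num.max 0 (d - mdist z x).

Lemma bump_ge0 z d x : 0 <= bump z d x.
Proof. by rewrite le_max lexx. Qed.

Lemma bump_gt0 z d x : (0 < bump z d x) = (mdist z x < d).
Proof. by rewrite lt_max ltxx/= subr_gt0. Qed.

Lemma continuous_mdist z : continuous (mdist z : T -> R).
Proof.
apply/continuous_ballP => x e e0; exists e => // y; rewrite ballEmdist/= => xy.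
have := metric_triangle z x y; have := metric_triangle z y x.
rewrite (metric_sym y x) ltr_norml => h1 h2; apply/andP; split; lra.
Qed.

Lemma continuous_bump z d : continuous (bump z d).
Proof.
move=> x; apply: (@continuous_max _ _ (cst 0) (fun x => d - mdist z x)).
  exact: cvg_cst.
by apply: cvgB; [exact: cvg_cst|exact: continuous_mdist].
Qed.

Lemma continuous_measurable f : continuous f ->
  measurable_fun [set: borel T] (f : borel T -> R).
Proof.
move=> cf; apply: (measurability (@RGenOpens.G R)).
  exact: RGenOpens.measurableE.
move=> _ [_ [a [b ->]] <-]; rewrite setTI; apply: sub_sigma_algebra.
by move/continuousP: cf; apply; exact: itv_open.
Qed.

End metric_continuity.

Section compact_metric.
Context {R : realType} {T : pointedMetricType R}.
Hypothesis cT : compact [set: T].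
Implicit Types (f g : T -> R) (x y z : T) (K : T -> T -> R).

Lemma continuous_bounded f : continuous f -> exists M : R, forall x, `|f x| <= M.
Proof.
move=> cf.
have T0 : [set: T] !=set0 by exists point.
have [|c _ fc] := @compact_EVT_max T R (fun x => `|f x|) setT T0 cT.
- by apply: continuous_subspaceT => x; apply: cvg_norm; exact: cf.
- by exists `|f c| => x; apply: fc; rewrite inE.
Qed.

Lemma continuous_bm f : continuous f ->
  bounded_measurable (f : borel T -> R).
Proof.
by move=> cf; split; [exact: continuous_measurable|exact: continuous_bounded].
Qed.

Lemma finite_net (d : R) : 0 < d ->
  exists s : seq T, forall x, exists2 z, z \in s & ball z d x.
Proof.
move=> d0; have := cT; rewrite compact_cover.
move=> /(_ T setT (fun z => (ball z d)^°)).
case=> [z _|x _|D' _ D'P]; first exact: open_interior.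
  exists x => //; exact: nbhsx_ballx.
exists (finmap.enum_fset D') => x; have [z zD' zx] := D'P x I.
by exists z => //; exact: interior_subset zx.
Qed.

Lemma partition_of_unity (d : R) : 0 < d ->
  exists n (z : nat -> T) (p : nat -> T -> R),
    [/\ forall i, continuous (p i), forall i x, 0 <= p i x,
        forall x, \sum_(i < n) p i x = 1 &
        forall i x, p i x != 0 -> ball (z i) d x].
Proof.
move=> d0; have [s sP] := finite_net d0.
pose b i := bump (nth point s i) d; pose S x := \sum_(i < size s) b i x.
have S0 x : 0 < S x.
  have [z zs zx] := sP x; rewrite ballEmdist/= -bump_gt0 in zx.
  have zi : (index z s < size s)%N by rewrite index_mem.
  rewrite /S (bigD1 (Ordinal zi))//= ltr_pwDl//; first by rewrite /b/= nth_index.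
  by apply: sumr_ge0 => i _; exact: bump_ge0.
have cS : continuous S by apply: continuous_sum => i; exact: continuous_bump.
exists (size s), (nth point s), (fun i x => b i x / S x); split.
- move=> i x; apply: cvgM; first exact: continuous_bump.
  by apply: cvgV; [rewrite gt_eqF|exact: (cS x)].
- by move=> i x; rewrite divr_ge0 ?bump_ge0// ltW.
- by move=> x; rewrite -mulr_suml -/(S x) divff ?gt_eqF.
- move=> i x; rewrite ballEmdist/=; apply: contraNT; rewrite -bump_gt0 -leNgt.
  by move=> bx; rewrite [b i x](@le_anti _ _ _ 0) ?mul0r// bx bump_ge0.
Qed.

Section kernel.
Variable K : T -> T -> R.
Hypothesis cK : continuous (fun p : T * T => K p.1 p.2).

Lemma kernel_continuousl y : continuous (fun x => K x y).
Proof.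
move=> x; apply: (@continuous_comp _ _ _ (fun x => (x, y)) (fun p => K p.1 p.2)).
  by apply: cvg_pair; [exact: cvg_id|exact: cvg_cst].
exact: cK.
Qed.

Lemma kernel_continuousr x : continuous (K x).
Proof.
move=> y; apply: (@continuous_comp _ _ _ (fun y => (x, y)) (fun p => K p.1 p.2)).
  by apply: cvg_pair; [exact: cvg_cst|exact: cvg_id].
exact: cK.
Qed.

Lemma kernel_bounded : exists2 M : R, 0 <= M & forall x y, `|K x y| <= M.
Proof.
have cTT : compact [set: T * T] by rewrite -setXTT; exact: compact_setX.
have TT0 : [set: T * T] !=set0 by exists (point, point).
have [|c _ fc] :=
  @compact_EVT_max (T * T)%type R (fun p => `|K p.1 p.2|) setT TT0 cTT.
- by apply: continuous_subspaceT => x; apply: cvg_norm; exact: cK.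
- by exists `|K c.1 c.2| => // x y; apply: (fc (x, y)); rewrite inE.
Qed.

(** The covering form of compactness is applied to the product space, with the
    radius d tending to 0 from the right. *)
Lemma kernel_unif_continuous (e : R) : 0 < e -> exists2 d : R, 0 < d &
  forall x x' y, ball x d x' -> `|K x y - K x' y| <= e.
Proof.
move=> e0.
have cTT : compact [set: T * T] by rewrite -setXTT; exact: compact_setX.
have /compact_near_coveringP/(_ _ (0 : R)^'+
  (fun d p => forall x', ball p.1 d x' -> `|K p.1 p.2 - K x' p.2| <= e)) := cTT.
case=> [[x0 y0] _ /=|d /= d0 dP].
  have e20 : 0 < e / 2 by rewrite divr_gt0.
  have cK0 : (fun p : T * T => K p.1 p.2) @ (x0, y0) --> K x0 y0.
    exact: (cK (x := (x0, y0))).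
  move/cvgrPdist_lt/(_ _ e20)/nbhs_ballP : cK0 => [r /= r0 rP].
  have r20 : 0 < r / 2 by rewrite divr_gt0.
  exists (ball (x0, y0) (r / 2), [set d | d <= r / 2]) => /=.
    by split; [exact: nbhsx_ballx|exact: nbhs_right_le].
  move=> [[x y] d] /= [[bx b_y] dr] x' xx'.
  have h1 : ball (x0, y0) r (x, y).
    by split; apply: le_ball bx || apply: le_ball b_y; lra.
  have h2 : ball (x0, y0) r (x', y).
    split => /=; last by apply: le_ball b_y; lra.
    by rewrite [r](splitr); apply: ball_triangle bx (le_ball dr xx').
  have /= k1 := rP _ h1; have /= k2 := rP _ h2.
  have := ler_distD (K x0 y0) (K x y) (K x' y); rewrite (distrC (K x y) (K x0 y0)); lra.
exists (d / 2) => [|x x' y xx']; first by rewrite divr_gt0.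
apply: (dP (d / 2) _ _ (x, y)) => //=; last by rewrite divr_gt0.
by rewrite sub0r normrN gtr0_norm ?divr_gt0//; lra.
Qed.

End kernel.

Definition continuous_functions : set (T -> R) := [set f : T -> R | continuous f].

Lemma bounded_linear_restrict (L : (T -> R) -> R) :
  bounded_linear (@bounded_measurable _ (borel T) R) L -> bounded_linear continuous_functions L.
Proof.
have cb := continuous_bm.
move=> [LD LZ [C C0 LC]]; split=> [f g cf cg|a f cf|].
- by rewrite LD//; exact: cb.
- by rewrite LZ//; exact: cb.
- by exists C => // f M cf fM; apply: LC => //; exact: cb.
Qed.

Lemma bounded_linear_kernel_continuous K (L : (T -> R) -> R) :
  continuous (fun p : T * T => K p.1 p.2) ->
  bounded_linear continuous_functions L -> continuous (fun x => L (K x)).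
Proof.
move=> cK BL; have [LD LZ [C C0 LC]] := BL.
apply/continuous_ballP => x e e0.
have e'0 : 0 < e / (C + 1) by rewrite divr_gt0//; lra.
have [d d0 dP] := kernel_unif_continuous cK e'0; exists d => // x' xx'.
have cK' := kernel_continuousr cK.
rewrite -(bounded_linearB BL); [|exact: cK'..|exact/continuousZf/cK'].
have -> : e = C * (e / (C + 1)) + e / (C + 1) by field; lra.
apply: le_lt_trans (LC _ (e / (C + 1)) _ _) _; last lra.
- exact/continuousBf/cK'/cK'.
- by move=> y; exact: dP.
Qed.

Lemma kernel_flip_continuous K : continuous (fun p : T * T => K p.1 p.2) ->
  continuous (fun p : T * T => K p.2 p.1).
Proof.
move=> cK p; apply: (@continuous_comp _ _ _ (fun p => (p.2, p.1))
  (fun p => K p.1 p.2)); last exact: cK.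
by apply: cvg_pair; [exact: cvg_snd|exact: cvg_fst].
Qed.

(** Fubini for functionals on continuous functions: for a finite sum of products
    the exchange is linearity, and a partition of unity subordinate to small
    balls approximates the kernel uniformly by such sums. *)
Lemma bounded_linear_exchange K (L1 L2 : (T -> R) -> R) :
  continuous (fun p : T * T => K p.1 p.2) ->
  bounded_linear continuous_functions L1 -> bounded_linear continuous_functions L2 ->
  L1 (fun y => L2 (fun x => K x y)) = L2 (fun x => L1 (K x)).
Proof.
move=> cK B1 B2; have [D1 Z1 [C1 C10 L1C]] := B1.
have [D2 Z2 [C2 C20 L2C]] := B2.
have cKl := kernel_continuousl cK; have cKr := kernel_continuousr cK.
have cL1 : continuous (fun x => L1 (K x)).
  exact: bounded_linear_kernel_continuous.
have cL2 : continuous (fun y => L2 (fun x => K x y)).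
  apply: (@bounded_linear_kernel_continuous (fun y x => K x y)) => //.
  exact: (kernel_flip_continuous cK).
have S0 : continuous_functions (fun=> 0) by exact: continuous_cst.
have SD f g : continuous_functions f -> continuous_functions g -> continuous_functions (fun x => f x + g x).
  exact: continuousDf.
apply/eqP; rewrite -subr_eq0 -normr_le0; apply/ler_addgt0Pl => e e0.
rewrite addr0; pose e' := e / (2 * C1 * C2 + 1).
have C12 : 0 <= 2 * C1 * C2 by rewrite !mulr_ge0.
have e'0 : 0 < e' by rewrite divr_gt0//; lra.
have eE : e = 2 * (C1 * (C2 * e')) + e' by rewrite /e'; field; lra.
have [d d0 dP] := kernel_unif_continuous cK e'0.
have [n [z [p [cp p0 p1 pd]]]] := partition_of_unity d0.
have Kp x y : `|K x y - \sum_(i < n) p i x * K (z i) y| <= e'.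
  rewrite -[K x y]mul1r -(p1 x) mulr_suml -sumrB.
  rewrite (le_trans (ler_norm_sum _ _ _))//.
  rewrite -[leRHS]mul1r -(p1 x) mulr_suml; apply: ler_sum => i _.
  rewrite -mulrBr normrM (ger0_norm (p0 _ _)).
  have [->|px] := eqVneq (p i x) 0; first by rewrite !mul0r.
  by rewrite ler_wpM2l// distrC; apply: dP; exact: pd.
have sumL L (c : nat -> R) (F : nat -> T -> R) : bounded_linear continuous_functions L ->
    (forall i, continuous (F i)) ->
    continuous (fun x => \sum_(i < n) c i * F i x) /\
    L (fun x => \sum_(i < n) c i * F i x) = \sum_(i < n) c i * L (F i).
  move=> BL cF; have cs i : continuous (fun x => c i * F i x).
    exact/continuousZf/cF.
  split; first exact: (continuous_sum (F := fun i x => c i * F i x)).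
  rewrite (bounded_linear_sum (F := fun i x => c i * F i x) n BL)//.
  have [_ LZ _] := BL.
  by apply: eq_bigr => i _; rewrite LZ//; exact: cF.
have approxL L f g (C E : R) : bounded_linear continuous_functions L -> continuous f ->
    continuous g -> (forall h M, continuous_functions h -> (forall x, `|h x| <= M) ->
    `|L h| <= C * M) -> (forall x, `|f x - g x| <= E) ->
    `|L f - L g| <= C * E.
  move=> BL cf cg LC fg; rewrite -(bounded_linearB BL)//; last first.
    exact: continuousZf.
  by apply: LC => //; exact: continuousBf.
pose m := \sum_(i < n) L2 (p i) * L1 (K (z i)).
have h2 y : `|L2 (fun x => K x y) - \sum_(i < n) L2 (p i) * K (z i) y| <= C2 * e'.
  under [X in _ - X]eq_bigr do rewrite mulrC.
  have [cs <-] := sumL _ (fun i => K (z i) y) p B2 cp.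
  apply: approxL B2 (cKl y) cs L2C _ => x.
  by under eq_bigr do rewrite mulrC; exact: Kp.
have h1 x : `|L1 (K x) - \sum_(i < n) L1 (K (z i)) * p i x| <= C1 * e'.
  under [X in _ - X]eq_bigr do rewrite mulrC.
  have [cs <-] := sumL _ (fun i => p i x) _ B1 (fun i => cKr (z i)).
  exact: approxL B1 (cKr x) cs L1C (Kp x).
have k1 : `|L1 (fun y => L2 (fun x => K x y)) - m| <= C1 * (C2 * e').
  have [cs] := sumL _ (fun i => L2 (p i)) _ B1 (fun i => cKr (z i)).
  by rewrite -/m => <-; exact: approxL B1 cL2 cs L1C h2.
have k2 : `|L2 (fun x => L1 (K x)) - m| <= C1 * (C2 * e').
  have [cs] := sumL _ (fun i => L1 (K (z i))) _ B2 cp.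
  under [X in _ = X -> _]eq_bigr do rewrite mulrC.
  rewrite -/m => <-.
  by rewrite mulrCA; exact: approxL B2 cL1 cs L2C h1.
have := ler_distD m (L1 (fun y => L2 (fun x => K x y))) (L2 (fun x => L1 (K x))).
rewrite (distrC m); lra.
Qed.

End compact_metric.

(** * Regularity of Borel charges *)

Section metric_regularity.
Context {R : realType} {T : pointedMetricType R}.
Implicit Types (m : {finite_measure set (borel T) -> \bar R}) (A : set T).

Lemma open_mdist_ball (y : T) (r : R) : open (ball y r : set T).
Proof.
rewrite ballEmdist (_ : [set _ | _] = mdist y @^-1` [set s : R | s < r])//.
by move/continuousP: (@continuous_mdist R T y); apply; exact: open_lt.
Qed.

Lemma open_borel A : open A -> measurable (A : set (borel T)).
Proof. exact: sub_sigma_algebra. Qed.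

Lemma closed_borel A : closed A -> measurable (A : set (borel T)).
Proof.
move=> cA; rewrite -[A]setCK.
apply: (@measurableC _ (borel T)); apply: open_borel.
exact: closed_openC.
Qed.

Definition sandwiched m A := forall e : R, 0 < e -> exists F U : set T,
  [/\ closed F, open U, F `<=` A, A `<=` U &
      (m (U `\` F : set (borel T)) <= e%:E)%E].

Lemma measure_cvg0_le m (G : nat -> set (borel T)) (e : R) : 0 < e ->
  (forall n, measurable (G n)) -> nonincreasing_seq G ->
  \bigcap_n G n = set0 -> exists n, (m (G n) <= e%:E)%E.
Proof.
move=> e0 mG niG G0.
have cm : m \o G @ \oo --> m (\bigcap_n G n).
  apply: nonincreasing_cvg_mu => //.
    by rewrite ltey_eq fin_num_measure.
  exact: bigcap_measurable.
rewrite G0 measure0 in cm.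
have /= : \forall n \near \oo, (m (G n) < e%:E)%E.
  apply: (cm [set x | (x < e%:E)%E]); apply: open_nbhs_nbhs; split => //.
  exact: open_ereal_lt_ereal.
by case=> n _ /(_ _ (leqnn n)) /ltW ?; exists n.
Qed.

(** An open set is the increasing union of the closed sets of points at distance
    at least 1/(n+1) from its complement. *)
Lemma open_sandwiched m A : open A -> sandwiched m A.
Proof.
move=> oA e e0.
pose F n := ~` \bigcup_(y in ~` A) ball y n.+1%:R^-1 : set T.
have cF n : closed (F n).
  by rewrite closedC; apply: bigcup_open => y _; exact: open_mdist_ball.
have FA n : F n `<=` A.
  move=> x Fx; apply: contrapT => Ax; apply: Fx; exists x => //.
  exact: ballxx.
have [n|p q pq| |n mn] := @measure_cvg0_le m (fun n => A `\` F n) e e0.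
- by apply: measurableD; [exact: open_borel|exact: closed_borel].
- apply/subsetPset; apply: setDS => x Fx [y Ay yx]; apply: Fx; exists y => //.
  apply: le_ball yx; rewrite lef_pV2 ?posrE ?ltr0n// ler_nat.
  by rewrite ltnS.
- apply/seteqP; split => // x Hx.
  have [Ax _] := Hx 0 I.
  have /nbhs_ballP[r /= r0 rA] : nbhs x A by exact: open_nbhs_nbhs.
  have [k _ kr] := near_infty_natSinv_lt (PosNum r0).
  have [_ nF] := Hx k I; exfalso; apply: nF => -[y nAy yx]; apply: nAy; apply: rA.
  apply: ball_sym; apply: le_ball yx.
  exact: ltW (kr k (leqnn k)).
- by exists (F n), A; split => //; exact: cF.
Qed.

Lemma setC_sandwiched m A : sandwiched m A -> sandwiched m (~` A).
Proof.
move=> sA e e0; have [F [U [cF oU FA AU mUF]]] := sA e e0.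
exists (~` U), (~` F); split; rewrite ?openC ?closedC//; first exact: subsetC.
  exact: subsetC.
by rewrite setDE setCK setIC -setDE.
Qed.

(** The union of the open sets is open; the union of the closed sets need not be
    closed, but finitely many of them already carry almost all its measure. *)
Lemma bigcup_sandwiched m (A : nat -> set T) : (forall n, sandwiched m (A n)) ->
  sandwiched m (\bigcup_n A n).
Proof.
move=> sA e e0; have e20 : 0 < e / 2 by rewrite divr_gt0.
have en0 n : 0 < e / 2 / (2 ^ n.+1)%:R.
  by rewrite divr_gt0// ltr0n expn_gt0.
have /choice[F /choice[U FU]] : forall n, exists F U : set T,
    [/\ closed F, open U, F `<=` A n, A n `<=` U &
      (m (U `\` F : set (borel T)) <= (e / 2 / (2 ^ n.+1)%:R)%:E)%E].
  by move=> n; exact: sA.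
pose V := \bigcup_n U n; pose G N := \bigcup_(n < N) F n.
have cF n : closed (F n) by have [] := FU n.
have oU n : open (U n) by have [] := FU n.
have oV : open V by apply: bigcup_open => n _.
have cG N : closed (G N) by apply: closed_bigcup => // n _; exact: cF.
pose H : set (borel T) := V `\` \bigcup_n F n.
have mF : measurable (\bigcup_n F n : set (borel T)).
  by apply: bigcup_measurable => n _; exact: closed_borel.
have mH : measurable H by apply: measurableD => //; exact: open_borel.
have mHe : (m H <= (e / 2)%:E)%E.
  have mD n : measurable (U n `\` F n : set (borel T)).
    by apply: measurableD; [exact: open_borel|exact: closed_borel].
  apply: le_trans (epsilon_trick0 xpredT (ltW e20)).
  have := @measure_sigma_subadditive _ _ _ m _ (fun n => U n `\` F n) mD mH.
  move/(_ _)/le_trans; apply.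
    by move=> x [[n _ Ux] nF]; exists n => //; split => // Fx; apply: nF; exists n.
  by apply: lee_nneseries => // n _; have [] := FU n.
have mHG N : measurable ((\bigcup_n F n) `\` G N : set (borel T)).
  by apply: measurableD => //; exact: closed_borel.
have [p q pq| |n mn] :=
    @measure_cvg0_le m (fun N => (\bigcup_n F n) `\` G N) (e / 2) e20 mHG.
- apply/subsetPset; apply: setDS => x [n /= np Fx]; exists n => //=.
  exact: leq_trans pq.
- apply/seteqP; split => // x Hx; have [[n _ Fx] _] := Hx 0 I.
  by have [_] := Hx n.+1 I; apply; exists n => /=.
- exists (G n), V; split => //.
  + by move=> x [k _ Fx]; exists k => //; have [_ _ + _ _] := FU k; apply.
  + by move=> x [k _ Ax]; exists k => //; have [_ _ _ + _] := FU k; apply.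
  rewrite [e](splitr) EFinD; apply: le_trans (leeD mHe mn).
  apply: le_trans (measureU2 _ mH (mHG n)).
  apply: le_measure; rewrite ?inE//.
  + by apply: measurableD; [exact: open_borel|exact: closed_borel].
  + exact: measurableU.
  move=> x [Vx nGx]; have [Fx|nFx] := pselect ((\bigcup_n F n) x).
    by right.
  by left.
Qed.

(** By the three lemmas above, the sandwiched sets form a sigma-algebra that
    contains the open sets. *)
Lemma borel_sandwiched m (A : set (borel T)) : measurable A -> sandwiched m A.
Proof.
apply: (smallest_sub (G := @open T) (C := sigma_algebra setT)
  (X := [set A : set T | sandwiched m A])).
  split => /=; first by apply: open_sandwiched; exact: open0.
    by move=> B sB; rewrite setTD; exact: setC_sandwiched.
  by move=> B sB; exact: bigcup_sandwiched.
by move=> B oB; exact: open_sandwiched.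
Qed.

Lemma closed_open_separation (F U : set T) : closed F -> open U -> F `<=` U ->
  exists f : T -> R, [/\ continuous f, forall x, 0 <= f x <= 1,
    forall x, F x -> f x = 1 & forall x, ~ U x -> f x = 0].
Proof.
move=> cF oU FU.
have sep : uniform_separator (~` U) F.
  apply: (iffLR (@normal_separatorP R T)) => //; first exact: pseudometric_normal.
    by rewrite closedC.
  by apply/seteqP; split => // x [nUx /FU].
exists (Urysohn (~` U) F); split.
- exact: Urysohn_continuous.
- move=> x; have /(_ (Urysohn (~` U) F x)) := @Urysohn_range _ R (~` U) F.
  by rewrite /= in_itv/=; apply; exists x.
- by move=> x Fx; apply: (Urysohn_sub1 (R := R) sep); exists x.
- by move=> x Ux; apply: (Urysohn_sub0 (R := R) sep); exists x.
Qed.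

End metric_regularity.

Section finite_charge_variation.
Context d (T : measurableType d) {R : realType} (nu : {charge set T -> \bar R}).
Variables (P N : set T) (PN : hahn_decomposition nu P N).

Let charge_variation_fin_num : fin_num_fun (charge_variation PN).
Proof. by move=> A mA; rewrite fin_numD !fin_num_measure. Qed.

HB.instance Definition _ := Measure_isFinite.Build _ _ _
  (charge_variation PN) charge_variation_fin_num.

End finite_charge_variation.

Section charges_on_compact_metric.
Context {R : realType} {T : pointedMetricType R}.
Hypothesis cT : compact [set: T].
Local Notation signed := (charge (borel T) R).

Lemma charge_regular (nu : signed) : regular nu.
Proof.
move=> A mA.
pose m : {finite_measure set (borel T) -> \bar R} :=
  [the {finite_measure set (borel T) -> \bar R} of charge_variation (hahn nu)].
have mE B : m B = Defs.total_variation nu B by [].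
have sA := borel_sandwiched m mA.
have mle (B C : set (borel T)) : measurable B -> measurable C -> B `<=` C ->
    (m B <= m C)%E.
  by move=> mB mC BC; apply: le_measure; rewrite ?inE.
have mfin (B : set (borel T)) : measurable B -> m B \is a fin_num.
  exact: fin_num_measure.
have mUF (B C : set (borel T)) : measurable B -> measurable C -> B `<=` C ->
    m C = (m B + m (C `\` B))%E.
  move=> mB mC BC; rewrite -measureU//; last 2 first.
  - exact: measurableD.
  - by rewrite setDE setICA setICr setI0.
  by rewrite setDUK.
rewrite -!mE; split; apply/eqP; rewrite eq_le; apply/andP; split.
- apply: le_ereal_inf_tmp => _ [U [oU AU] <-]; rewrite -mE.
  by apply: mle => //; exact: open_borel.
- apply/lee_addgt0Pr => e e0; have [F [U [cF oU FA AU mFU]]] := sA e e0.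
  apply: (@le_trans _ _ (m U)).
    by apply: ereal_inf_lbound; exists U => //; rewrite mE.
  have mU := open_borel oU; have mF := closed_borel cF.
  rewrite (mUF A U)//; apply: leeD2l; apply: le_trans mFU.
  apply: mle; [exact: measurableD|exact: measurableD|exact: setDS].
- apply/lee_addgt0Pr => e e0; have [F [U [cF oU FA AU mFU]]] := sA e e0.
  have mU := open_borel oU; have mF := closed_borel cF.
  apply: (@le_trans _ _ (m F + e%:E)%E).
    rewrite (mUF F A)//; apply: leeD2l; apply: le_trans mFU.
    apply: mle; [exact: measurableD|exact: measurableD|exact: setSD].
  apply: leeD2r; apply: ereal_sup_ubound; exists F; last by rewrite mE.
  by split => //; apply: subclosed_compact cF cT _.
- apply: ge_ereal_sup => _ [F [cF FA] <-]; rewrite -mE; apply: mle => //.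
  apply: closed_borel; apply: compact_closed cF.
  exact: (@metric_hausdorff R T).
Qed.

Lemma signed_measuresT : signed_measures = [set: signed].
Proof. by apply/seteqP; split => // nu _; exact: charge_regular. Qed.

(** By regularity a Borel set is nearly a closed set inside an open set, and a
    Urysohn function then stands for its indicator. *)
Lemma charge_eq0 (nu : signed) :
  (forall f : T -> R, continuous f -> cintegral nu f = 0) ->
  eq_charge nu czero.
Proof.
move=> nu0 A mA.
set p := jordan_pos (hahn nu); set n := jordan_neg (hahn nu).
pose m : {finite_measure set (borel T) -> \bar R} :=
  [the {finite_measure set (borel T) -> \bar R} of charge_variation (hahn nu)].
have sA := borel_sandwiched m mA.
suff pn : fine (p A) = fine (n A).
  have pA : p A \is a fin_num by exact: fin_num_measure.
  have nA : n A \is a fin_num by exact: fin_num_measure.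
  by rewrite jordan_decompB// -/p -/n -(fineK pA) -(fineK nA) pn subee.
apply/eqP; rewrite -subr_eq0 -normr_le0; apply/ler_addgt0Pl => e e0.
rewrite addr0; have e20 : 0 < e / 2 by rewrite divr_gt0.
have [F [U [cF oU FA AU mFU]]] := sA _ e20.
have [f [cf f01 fF fU]] := closed_open_separation cF oU (subset_trans FA AU).
have mU := open_borel oU; have mF := closed_borel cF.
have mUF := measurableD mU mF.
have close (q : {finite_measure set (borel T) -> \bar R}) :
    (q (U `\` F : set (borel T)) <= (e / 2)%:E)%E ->
    `|\int[q]_x f x - fine (q A)| <= e / 2.
  move=> qe; have bf := continuous_bm cT cf.
  have bA := @bounded_measurable_indic _ _ R A mA.
  have iB := @bounded_measurable_integrable _ _ _ q _
    (bounded_measurableD bf (bounded_measurableZ (-1) bA)).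
  have iUF := @bounded_measurable_integrable _ _ _ q _
    (@bounded_measurable_indic _ _ R _ mUF).
  rewrite -Rintegral_indic// -RintegralB//; last 2 first.
  - exact: bounded_measurable_integrable bf.
  - exact: bounded_measurable_integrable bA.
  under eq_Rintegral do rewrite -mulN1r.
  rewrite (le_trans (le_normr_Rintegral _ _))//.
  apply: (@le_trans _ _ (\int[q]_x \1_(U `\` F : set (borel T)) x)).
    apply: le_Rintegral => //; first exact: (integrable_abse iB).
    move=> x _; rewrite mulN1r !indicE; have /andP[fx0 fx1] := f01 x.
    have [Fx|nFx] := pselect (F x).
      by rewrite fF// mem_set ?subrr ?normr0//; exact: FA.
    have [Ux|nUx] := pselect (U x).
      rewrite (mem_set (_ : (U `\` F) x))//.
      case: (x \in A); rewrite ler_norml /=; apply/andP; split; lra.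
    rewrite fU// memNset; first by rewrite subrr normr0.
    by move/AU.
  rewrite Rintegral_indic// -lee_fin fineK//; exact: fin_num_measure.
have mle (q : {measure set (borel T) -> \bar R}) : (forall B, q B <= m B)%E ->
    (q (U `\` F : set (borel T)) <= (e / 2)%:E)%E.
  by move=> qm; apply: le_trans mFU.
have /close hp : (p (U `\` F : set (borel T)) <= (e / 2)%:E)%E.
  by apply: mle => B; rewrite -[m B]/(p B + n B)%E leeDl.
have /close hn : (n (U `\` F : set (borel T)) <= (e / 2)%:E)%E.
  by apply: mle => B; rewrite -[m B]/(p B + n B)%E leeDr.
have /eqP := nu0 _ cf; rewrite /cintegral subr_eq0 -/p -/n => /eqP fpn.
move: hp; rewrite fpn => hp.
have := ler_distD (\int[n]_x f x) (fine (p A)) (fine (n A)).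
rewrite (distrC (fine (p A)) (\int[n]_x f x)); lra.
Qed.

End charges_on_compact_metric.

(** * Energies as a quadratic form *)

Lemma discriminant_le {R : realFieldType} (a b c : R) : 0 <= c ->
  (forall t, 0 <= a + 2 * t * b + t ^+ 2 * c) -> b ^+ 2 <= a * c.
Proof.
rewrite le_eqVlt => /predU1P[<- H|c0 H].
  (* When c = 0 the form is affine in t, and takes the value -1 if b != 0. *)
  have [->|b0] := eqVneq b 0; first by rewrite expr0n/= mulr0.
  have := H (- (a + 1) / (2 * b)).
  rewrite (_ : a + _ + _ = -1) ?ler0N1//.
  by field.
have := H (- b / c).
rewrite (_ : a + _ + _ = (a * c - b ^+ 2) / c); last by field; rewrite gt_eqF.
by rewrite pmulr_lge0 ?invr_gt0// subr_ge0.
Qed.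

Section energy_algebra.
Context {R : realType} {T : pointedMetricType R}.
Hypothesis cT : compact [set: T].
Local Notation signed := (charge (borel T) R).
Local Notation bm := (@bounded_measurable _ (borel T) R).
Implicit Types (nu : signed) (K : T -> T -> R).

Definition mutual_energy K nu1 nu2 : R :=
  cintegral nu1 (fun y => cintegral nu2 (fun x => K x y)).

Definition mass nu : R := fine (nu setT).

Lemma cintegral_bounded_linear nu : bounded_linear (continuous_functions (T := T)) (cintegral nu).
Proof.
by apply: (bounded_linear_restrict cT); exact: bounded_linear_cintegral.
Qed.

Lemma cintegral_cst nu (a : R) : cintegral nu (fun=> a) = a * mass nu.
Proof.
have [_ Z _] := bounded_linear_cintegral nu.
rewrite (_ : (fun=> a) = (fun x => a * (\1_(setT : set (borel T)) x : R))).
  by rewrite Z ?cintegral_indic//; exact: bounded_measurable_indic.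
by apply/funext => x; rewrite indicE in_setT mulr1.
Qed.

Lemma mass_eqP nu (a : R) : (nu setT = a%:E) <-> mass nu = a.
Proof.
by split=> [|<-]; rewrite /mass ?fineK//; [move=> ->|exact: fin_num_measure].
Qed.

Section fixed_kernel.
Variable K : T -> T -> R.
Hypothesis kK : is_kernel K.

Let cK := proj1 kK.
Let symK : forall x y, K x y = K y x := proj2 kK.

Lemma kernel_bml y : bm (fun x => K x y).
Proof. by apply: (continuous_bm cT); exact: kernel_continuousl. Qed.

Lemma potential_continuous nu :
  continuous (fun y : T => cintegral nu (fun x => K x y)).
Proof.
apply: (bounded_linear_kernel_continuous (K := fun y x => K x y) cT).
  exact: kernel_flip_continuous.
exact: cintegral_bounded_linear.
Qed.

Lemma potential_bm nu : bm (fun y : T => cintegral nu (fun x => K x y)).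
Proof. by apply: (continuous_bm cT); exact: potential_continuous. Qed.

Lemma mutual_energyC nu1 nu2 : mutual_energy K nu1 nu2 = mutual_energy K nu2 nu1.
Proof.
rewrite [LHS](bounded_linear_exchange cT cK (cintegral_bounded_linear nu1)
  (cintegral_bounded_linear nu2)).
congr (cintegral nu2 _); apply/funext => x.
by congr (cintegral nu1 _); apply/funext => y; rewrite symK.
Qed.

Lemma mutual_energyDl nu1 nu2 nu : mutual_energy K (cadd nu1 nu2) nu =
  mutual_energy K nu1 nu + mutual_energy K nu2 nu.
Proof. by apply: cintegralD; exact: potential_bm. Qed.

Lemma mutual_energyZl a nu1 nu : mutual_energy K (cscale a nu1) nu =
  a * mutual_energy K nu1 nu.
Proof. by apply: cintegralZ; exact: potential_bm. Qed.

Lemma mutual_energyDr nu1 nu2 nu : mutual_energy K nu (cadd nu1 nu2) =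
  mutual_energy K nu nu1 + mutual_energy K nu nu2.
Proof. by rewrite mutual_energyC mutual_energyDl !(mutual_energyC nu). Qed.

Lemma mutual_energyZr a nu1 nu : mutual_energy K nu (cscale a nu1) =
  a * mutual_energy K nu nu1.
Proof. by rewrite mutual_energyC mutual_energyZl (mutual_energyC nu). Qed.

Lemma eq_energy nu1 nu2 : eq_charge nu1 nu2 -> energy K nu1 = energy K nu2.
Proof.
move=> nu12; rewrite /energy (eq_cintegral nu12); last exact: potential_bm.
congr (cintegral nu2 _); apply/funext => y; apply: eq_cintegral => //.
exact: kernel_bml.
Qed.

Lemma energy_lincomb nu1 nu2 (a b : R) :
  energy K (cadd (cscale a nu1) (cscale b nu2)) = a ^+ 2 * energy K nu1 +
    2 * a * b * mutual_energy K nu1 nu2 + b ^+ 2 * energy K nu2.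
Proof.
rewrite -![energy K _]/(mutual_energy K _ _).
rewrite mutual_energyDl !mutual_energyDr !mutual_energyZl !mutual_energyZr.
rewrite (mutual_energyC nu2 nu1).
move: (mutual_energy K nu1 nu1) (mutual_energy K nu1 nu2).
by move: (mutual_energy K nu2 nu2) => x y z; ring.
Qed.

Lemma energyZ nu (a : R) : energy K (cscale a nu) = a ^+ 2 * energy K nu.
Proof.
rewrite -![energy K _]/(mutual_energy K _ _) mutual_energyZl mutual_energyZr.
by rewrite mulrA.
Qed.

Lemma energy_kernel_addC (C : R) nu :
  energy (fun x y => K x y + C) nu = energy K nu + C * mass nu ^+ 2.
Proof.
have [D Z _] := bounded_linear_cintegral nu.
rewrite /energy.
rewrite (_ : (fun y => cintegral nu (fun x => K x y + C)) =
  (fun y => cintegral nu (fun x => K x y) + C * mass nu)).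
  rewrite D ?cintegral_cst; first by rewrite -mulrA.
    exact: potential_bm.
  exact: bounded_measurable_cst.
apply/funext => y; rewrite (D (fun x => K x y)) ?cintegral_cst//.
  exact: kernel_bml.
exact: bounded_measurable_cst.
Qed.

End fixed_kernel.
End energy_algebra.

(** * Equivalence of definiteness, minimality and convexity *)

Section equivalences.
Context {R : realType} {T : pointedMetricType R}.
Hypothesis cT : compact [set: T].
Local Notation signed := (charge (borel T) R).
Implicit Types (nu : signed) (S : set signed).

Definition cdiff nu1 nu2 : signed := cadd nu1 (cscale (-1) nu2).

Lemma eq_charge_fine nu1 nu2 : eq_charge nu1 nu2 <->
  forall A : set (borel T), measurable A -> fine (nu1 A) = fine (nu2 A).
Proof.
split=> H A mA; first by rewrite H.
have f1 : nu1 A \is a fin_num by exact: fin_num_measure.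
have f2 : nu2 A \is a fin_num by exact: fin_num_measure.
by rewrite -(fineK f1) -(fineK f2) H.
Qed.

Lemma fine_cscale nu (a : R) (A : set (borel T)) : measurable A ->
  fine (cscale a nu A) = a * fine (nu A).
Proof. by move=> mA; rewrite /cscale fineM//; exact: fin_num_measure. Qed.

Lemma fine_cadd_scaler nu1 nu2 (b : R) (A : set (borel T)) : measurable A ->
  fine (cadd nu1 (cscale b nu2) A) = fine (nu1 A) + b * fine (nu2 A).
Proof.
move=> mA; rewrite /cadd/= /cscale fineD ?fineM ?fin_numM//;
  exact: fin_num_measure.
Qed.

Lemma fine_czero (A : set (borel T)) : fine ((czero : signed) A) = 0.
Proof. by []. Qed.

Lemma cdiff_eq0 nu1 nu2 : eq_charge (cdiff nu1 nu2) czero <-> eq_charge nu1 nu2.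
Proof.
rewrite !eq_charge_fine; split=> H A mA; have := H A mA.
- by rewrite fine_cadd_scaler// fine_czero => h; lra.
- by rewrite fine_cadd_scaler// fine_czero => ->; rewrite mulN1r subrr.
Qed.

Lemma mass_caddZ nu1 nu2 (b : R) :
  mass (cadd nu1 (cscale b nu2)) = mass nu1 + b * mass nu2.
Proof. exact: fine_cadd_scaler. Qed.

Lemma neutralP nu : neutral_measures nu <-> mass nu = 0.
Proof.
split=> [[_ /mass_eqP//]|nu0]; split; last exact/mass_eqP.
exact: charge_regular.
Qed.

Lemma signed_probP nu : signed_prob_measures nu <-> mass nu = 1.
Proof.
split=> [[_ /mass_eqP//]|nu0]; split; last exact/mass_eqP.
exact: charge_regular.
Qed.

Lemma prob_signed_prob : prob_measures `<=` signed_prob_measures (T := T).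
Proof.
move=> _ [P _ <-]; split; first exact: charge_regular.
exact: probability_setT.
Qed.

Section kernel.
Variable K : T -> T -> R.
Hypothesis kK : is_kernel K.

Lemma energy_caddZ nu1 nu2 (b : R) : energy K (cadd nu1 (cscale b nu2)) =
  energy K nu1 + 2 * b * mutual_energy K nu1 nu2 + b ^+ 2 * energy K nu2.
Proof.
rewrite -![energy K _]/(mutual_energy K _ _) mutual_energyDl//.
rewrite !mutual_energyDr// !mutual_energyZl// !mutual_energyZr//.
rewrite (mutual_energyC cT kK nu2 nu1).
move: (mutual_energy K nu1 nu1) (mutual_energy K nu1 nu2).
by move: (mutual_energy K nu2 nu2) => x y z; ring.
Qed.

Lemma energy_mixture (t : R) nu1 nu2 : energy K (mixture t nu1 nu2) =
  (1 - t) * energy K nu1 + t * energy K nu2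
  - t * (1 - t) * energy K (cdiff nu1 nu2).
Proof. by rewrite energy_lincomb// energy_caddZ//; ring. Qed.

(** The convexity defect of the energy along a segment is a multiple of the
    energy of the difference of its endpoints. *)
Lemma strictly_convexP S : strictly_convex_energy_on S K <->
  forall nu1 nu2, S nu1 -> S nu2 -> 0 <= energy K (cdiff nu1 nu2) /\
    (energy K (cdiff nu1 nu2) = 0 -> eq_charge nu1 nu2).
Proof.
split=> H nu1 nu2 S1 S2; have [H1 H2] := H _ _ S1 S2; split.
- have h : 0 <= (2 : R)^-1 <= 1 by lra.
  by have := H1 _ h; rewrite energy_mixture; lra.
- move=> e0; apply: contrapT => /H2 h.
  have h2 : 0 < (2 : R)^-1 < 1 by lra.
  by have := h _ h2; rewrite energy_mixture e0 mulr0 subr0 ltxx.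
- move=> t /andP[t0 t1]; rewrite energy_mixture gerBl.
  by rewrite !mulr_ge0// subr_ge0.
- move=> n12 t /andP[t0 t1]; rewrite energy_mixture gtrBl.
  have e0 : 0 < energy K (cdiff nu1 nu2).
    by rewrite lt_neqAle H1 andbT eq_sym; apply/eqP => /H2.
  by rewrite !mulr_gt0// subr_gt0.
Qed.

Lemma cond_strictly_convex : cond_strictly_positive_definite K ->
  strictly_convex_energy_on signed_prob_measures K.
Proof.
move=> [K0 Keq]; apply/strictly_convexP => nu1 nu2 /signed_probP m1 /signed_probP m2.
have nd : neutral_measures (cdiff nu1 nu2).
  by apply/neutralP; rewrite mass_caddZ m1 m2; ring.
by split=> [|/(Keq _ nd)/cdiff_eq0//]; exact: K0.
Qed.

Lemma strictly_convex_subset S1 S2 : S1 `<=` S2 ->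
  strictly_convex_energy_on S2 K -> strictly_convex_energy_on S1 K.
Proof. by move=> S12 H nu1 nu2 /S12 h1 /S12; exact: H. Qed.

(** The positive and negative parts of a neutral charge have the same mass c;
    [mnormalize] falls back on P0 when c = 0. *)
Lemma neutral_jordan (P0 : probability (borel T) R) nu : mass nu = 0 ->
  exists P1 P2 : probability (borel T) R, exists c : R,
    eq_charge nu (cscale c
      (cdiff (charge_of_finite_measure P1) (charge_of_finite_measure P2))).
Proof.
move=> m0; set p := jordan_pos (hahn nu); set n := jordan_neg (hahn nu).
pose P1 := [the probability (borel T) R of mnormalize p P0].
pose P2 := [the probability (borel T) R of mnormalize n P0].
have pf A : measurable A -> p A \is a fin_num by move=> ?; exact: fin_num_measure.
have nf A : measurable A -> n A \is a fin_num by move=> ?; exact: fin_num_measure.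
have normE (q : {measure set (borel T) -> \bar R}) A :
    (forall A, measurable A -> q A \is a fin_num) -> measurable A ->
    fine (q A) = fine (q setT) * fine (mnormalize q P0 A).
  move=> qf mA; rewrite /mnormalize.
  have [q0|q0] /= := eqVneq (q setT) 0%E.
    rewrite q0/= mul0r (_ : q A = 0%E)//; apply/eqP.
    by rewrite eq_le measure_ge0 andbT -q0; apply: le_measure; rewrite ?inE.
  have -> /= : (q setT == +oo)%E = false.
    by apply/negbTE; have := qf _ measurableT; rewrite fin_numE => /andP[].
  rewrite fineM ?qf//= mulrCA mulfV ?mulr1// fine_eq0 ?qf//.
exists P1, P2, (fine (p setT)); apply/eq_charge_fine => A mA.
have cE : fine (n setT) = fine (p setT).
  move: m0; rewrite /mass jordan_decompB// fineB ?pf ?nf// -/p -/n.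
  by move=> h; lra.
rewrite jordan_decompB// fineB ?pf ?nf// -/p -/n (normE p)// (normE n)// cE.
by rewrite fine_cscale// fine_cadd_scaler//= mulN1r mulrBr.
Qed.

Lemma convex_cond_strictly (P0 : probability (borel T) R) :
  strictly_convex_energy_on prob_measures K -> cond_strictly_positive_definite K.
Proof.
move=> /strictly_convexP H.
have key nu : neutral_measures nu -> 0 <= energy K nu /\
    (energy K nu = 0 -> eq_charge nu czero).
  move=> /neutralP/(neutral_jordan P0)[P1 [P2 [c nuE]]].
  have [|| h1 h2] := H (charge_of_finite_measure P1) (charge_of_finite_measure P2).
  - by exists P1.
  - by exists P2.
  rewrite (eq_energy cT kK nuE) energyZ//; split.
    by rewrite mulr_ge0// sqr_ge0.
  move=> e0; apply/eq_charge_fine => A mA; rewrite nuE// fine_cscale//.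
  move/eqP: e0; rewrite mulf_eq0 sqrf_eq0 => /orP[/eqP ->|/eqP/h2/cdiff_eq0 d0].
    by rewrite mul0r.
  by rewrite d0// fine_czero mulr0.
by split=> nu /key[].
Qed.

Section invariant_measure.
Variable mu : probability (borel T) R.
Let m : signed := charge_of_finite_measure mu.
Hypothesis mu_invariant : forall x, potential K m x = energy K m.

Lemma mass_mu : mass m = 1.
Proof. by rewrite /mass/m/= /charge_of_finite_measure probability_setT. Qed.

Lemma mutual_energy_mu nu : mutual_energy K nu m = energy K m * mass nu.
Proof.
rewrite -cintegral_cst; congr (cintegral nu _); apply/funext => y.
rewrite -(mu_invariant y); congr (cintegral m _); apply/funext => x.
exact: (proj2 kK).
Qed.

(** Invariance makes the measure orthogonal to neutral measures, so projecting
    along it onto them splits off a multiple of the squared mass. *)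
Lemma energy_project nu : energy K (cadd nu (cscale (- mass nu) m)) =
  energy K nu - energy K m * mass nu ^+ 2.
Proof. by rewrite energy_caddZ mutual_energy_mu; ring. Qed.

Lemma neutral_project nu : neutral_measures (cadd nu (cscale (- mass nu) m)).
Proof. by apply/neutralP; rewrite mass_caddZ mass_mu; ring. Qed.

Lemma cond_strictly_mod_cst : cond_strictly_positive_definite K ->
  strictly_positive_definite_mod_cst K.
Proof.
move=> [K0 Keq]; exists (1 - energy K m).
have E nu : energy (fun x y => K x y + (1 - energy K m)) nu =
    energy K (cadd nu (cscale (- mass nu) m)) + mass nu ^+ 2.
  by rewrite energy_kernel_addC// energy_project; ring.
have P0 nu := K0 _ (neutral_project nu).
split=> nu _; rewrite E; first by rewrite addr_ge0// sqr_ge0.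
move=> /eqP; rewrite paddr_eq0 ?sqr_ge0// sqrf_eq0 => /andP[/eqP e0 /eqP m0].
have := Keq _ (neutral_project nu) e0; rewrite m0 oppr0 !eq_charge_fine.
by move=> H A mA; rewrite -H// fine_cadd_scaler// mul0r addr0.
Qed.

Lemma mod_cst_cond_strictly : strictly_positive_definite_mod_cst K ->
  cond_strictly_positive_definite K.
Proof.
move=> [C [K0 Keq]].
have E nu : neutral_measures nu ->
    energy (fun x y => K x y + C) nu = energy K nu.
  by move/neutralP => m0; rewrite energy_kernel_addC// m0 expr0n/= mulr0 addr0.
have S nu : signed_measures nu by rewrite (signed_measuresT cT).
split=> nu nnu; rewrite -E//; first exact: K0.
exact: Keq.
Qed.

Lemma cond_strictly_minimizer : cond_strictly_positive_definite K ->
  is_unique_minimizer K signed_prob_measures m.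
Proof.
move=> [K0 Keq].
have E nu : mass nu = 1 -> energy K (cdiff nu m) = energy K nu - energy K m.
  by move=> m1; have := energy_project nu; rewrite m1 expr1n mulr1.
have N nu : mass nu = 1 -> neutral_measures (cdiff nu m).
  by move=> m1; have := neutral_project nu; rewrite m1.
have mmin : is_minimizer K signed_prob_measures m.
  split=> [|nu /signed_probP m1]; first exact/signed_probP/mass_mu.
  by rewrite -subr_ge0 -E//; exact/K0/N.
split=> // nu [/signed_probP m1 numin]; apply/cdiff_eq0/Keq; first exact: N.
apply/eqP; rewrite E// eq_le subr_le0 subr_ge0 numin; last by case: mmin.
by case: mmin => _; apply; exact/signed_probP.
Qed.

Lemma minimizer_cond_strictly : is_unique_minimizer K signed_prob_measures m ->
  cond_strictly_positive_definite K.
Proof.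
move=> [[_ mmin] muniq].
have E nu : mass nu = 0 ->
    energy K (cadd nu (cscale 1 m)) = energy K nu + energy K m.
  by move=> m0; rewrite energy_caddZ mutual_energy_mu m0; ring.
have S nu : mass nu = 0 -> signed_prob_measures (cadd nu (cscale 1 m)).
  by move=> m0; apply/signed_probP; rewrite mass_caddZ m0 mass_mu; ring.
split=> nu /neutralP m0; first by have := mmin _ (S _ m0); rewrite E//; lra.
move=> e0; have /muniq/eq_charge_fine H :
    is_minimizer K signed_prob_measures (cadd nu (cscale 1 m)).
  by split=> [|nu' Snu']; [exact: S|rewrite E// e0 add0r; exact: mmin].
apply/eq_charge_fine => A mA; have := H A mA.
by rewrite fine_cadd_scaler// fine_czero => h; lra.
Qed.

End invariant_measure.
End kernel.
End equivalences.

(** * The integral operator on square-integrable functions *)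

Section inner_product.
Context {R : realType} d {T : measurableType d} (mu : probability T R).
Implicit Types (f g h : T -> R).

Local Notation L2 := (Lfun mu 2%:E).

Definition ip f g : R := \int[mu]_x (f x * g x).

Lemma L2_bounded_measurable f : bounded_measurable f -> f \in L2.
Proof.
move=> [mf [M fM]]; rewrite inE; apply/andP; split; rewrite inE//=.
rewrite /finite_norm unlock poweR_lty//.
have iM : mu.-integrable setT (EFin \o (fun=> `|M| ^+ 2 : R)).
  exact: finite_measure_integrable_cst.
have : mu.-integrable setT (EFin \o (fun x => f x ^+ 2)).
  apply: le_integrable iM => //.
    by apply/measurable_EFinP; exact: measurable_funX.
  move=> x _ /=; rewrite lee_fin !normrX normr_id lerXn2r ?nnegrE//.
  exact: le_trans (fM x) (ler_norm _).
move=> /integrableP[_]; apply: le_lt_trans; rewrite le_eqVlt; apply/orP; left.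
by apply/eqP/eq_integral => x _ /=; rewrite normrX powR_mulrn.
Qed.

Lemma L2D f g : f \in L2 -> g \in L2 -> (fun x => f x + g x) \in L2.
Proof. exact: (@Lfun_addr_closed _ _ _ mu 2%:E (lee1n 2)).2. Qed.

Lemma L2Z (a : R) f : f \in L2 -> (fun x => a * f x) \in L2.
Proof.
move=> fL; rewrite (_ : (fun _ => _) = a \o* f).
  by apply: Lfun_scale => //; rewrite ler1n.
by apply/funext => x /=; rewrite mulrC.
Qed.

Lemma L2B f g : f \in L2 -> g \in L2 -> (fun x => f x - g x) \in L2.
Proof.
move=> fL gL; under eq_fun do rewrite -mulN1r.
by apply: L2D => //; exact: L2Z.
Qed.

Lemma L2_cst (a : R) : (fun=> a) \in L2.
Proof. exact: Lfun_cst. Qed.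

Lemma L2_sum n (F : nat -> T -> R) : (forall i, F i \in L2) ->
  (fun x => \sum_(i < n) F i x) \in L2.
Proof.
move=> FL; elim: n => [|n IH].
  by under eq_fun do rewrite big_ord0; exact: L2_cst.
by under eq_fun do rewrite big_ord_recr/=; exact: L2D.
Qed.

Lemma L2M_integrable f g : f \in L2 -> g \in L2 ->
  mu.-integrable setT (EFin \o (fun x => f x * g x)).
Proof. by move=> fL gL; apply/Lfun1_integrable/Lfun2_mul_Lfun1. Qed.

Lemma L2_integrable f : f \in L2 -> mu.-integrable setT (EFin \o f).
Proof.
move=> fL; have := L2M_integrable fL (L2_cst 1).
by apply: eq_integrable => // x _ /=; rewrite mulr1.
Qed.

Lemma L2_measurable f : f \in L2 -> measurable_fun setT f.
Proof. by move=> /L2_integrable/(measurable_int mu)/measurable_EFinP. Qed.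

Lemma ipC f g : ip f g = ip g f.
Proof. by apply: eq_Rintegral => x _; rewrite mulrC. Qed.

Lemma ipDl f g h : f \in L2 -> g \in L2 -> h \in L2 ->
  ip (fun x => f x + g x) h = ip f h + ip g h.
Proof.
move=> fL gL hL; rewrite /ip; under eq_Rintegral do rewrite mulrDl.
by rewrite RintegralD//; exact: L2M_integrable.
Qed.

Lemma ipZl (a : R) f h : f \in L2 -> h \in L2 ->
  ip (fun x => a * f x) h = a * ip f h.
Proof.
move=> fL hL; rewrite /ip; under eq_Rintegral do rewrite -mulrA.
by rewrite RintegralZl//; exact: L2M_integrable.
Qed.

Lemma ipBl f g h : f \in L2 -> g \in L2 -> h \in L2 ->
  ip (fun x => f x - g x) h = ip f h - ip g h.
Proof.
move=> fL gL hL; rewrite /ip; under eq_Rintegral do rewrite mulrBl.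
by rewrite RintegralB//; exact: L2M_integrable.
Qed.

Lemma ipDr f g h : f \in L2 -> g \in L2 -> h \in L2 ->
  ip h (fun x => f x + g x) = ip h f + ip h g.
Proof. by move=> fL gL hL; rewrite ipC ipDl// !(ipC _ h). Qed.

Lemma ipZr (a : R) f h : f \in L2 -> h \in L2 ->
  ip h (fun x => a * f x) = a * ip h f.
Proof. by move=> fL hL; rewrite ipC ipZl// (ipC h). Qed.

Lemma ipBr f g h : f \in L2 -> g \in L2 -> h \in L2 ->
  ip h (fun x => f x - g x) = ip h f - ip h g.
Proof. by move=> fL gL hL; rewrite ipC ipBl// !(ipC _ h). Qed.

Lemma ip_suml n (F : nat -> T -> R) h : (forall i, F i \in L2) -> h \in L2 ->
  ip (fun x => \sum_(i < n) F i x) h = \sum_(i < n) ip (F i) h.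
Proof.
move=> FL hL; elim: n => [|n IH].
  rewrite big_ord0 /ip; under eq_Rintegral do rewrite big_ord0 mul0r.
  by rewrite Rintegral_cst// mul0r.
rewrite big_ord_recr/= -IH -ipDl//; last exact: L2_sum.
by apply: eq_Rintegral => x _; rewrite big_ord_recr.
Qed.

Lemma ip_ge0 f : 0 <= ip f f.
Proof. by apply: Rintegral_ge0 => x _; rewrite -expr2 sqr_ge0. Qed.

Lemma ip_cauchy_schwarz f g : f \in L2 -> g \in L2 ->
  ip f g ^+ 2 <= ip f f * ip g g.
Proof.
move=> fL gL; apply: discriminant_le => [|t]; first exact: ip_ge0.
have -> : ip f f + 2 * t * ip f g + t ^+ 2 * ip g g =
    ip (fun x => f x + t * g x) (fun x => f x + t * g x).
  have tgL := L2Z t gL.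
  rewrite ipDl ?ipDr ?L2D// !ipZl ?L2D// !ipZr// ?ipZl// (ipC g f); ring.
exact: ip_ge0.
Qed.

Lemma ip_normP f g (c e : R) : 0 <= c -> 0 <= e -> f \in L2 -> g \in L2 ->
  ip f f <= c ^+ 2 -> ip g g <= e ^+ 2 -> `|ip f g| <= c * e.
Proof.
move=> c0 e0 fL gL fc ge; rewrite -ler_sqr ?nnegrE ?mulr_ge0//.
rewrite real_normK ?num_real// exprMn.
apply: le_trans (ip_cauchy_schwarz fL gL) _.
by apply: ler_pM => //; exact: ip_ge0.
Qed.

Lemma ip_bounded f (c : R) : f \in L2 -> (forall x, `|f x| <= c) ->
  ip f f <= c ^+ 2.
Proof.
move=> fL fc; have -> : c ^+ 2 = \int[mu]_x (c ^+ 2).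
  by rewrite Rintegral_cst//= probability_setT mulr1.
apply: le_Rintegral => //; first exact: L2M_integrable.
  exact: finite_measure_integrable_cst.
move=> x _; rewrite -expr2 -[f x ^+ 2]real_normK ?num_real//.
by rewrite lerXn2r ?nnegrE// (le_trans _ (fc x)).
Qed.

Lemma ip1r f : ip f (fun=> 1) = \int[mu]_x f x.
Proof. by apply: eq_Rintegral => x _; rewrite mulr1. Qed.

End inner_product.

Section operator.
Context {R : realType} {T : pointedMetricType R}.
Hypothesis cT : compact [set: T].
Variable mu : probability (borel T) R.
Local Notation signed := (charge (borel T) R).
Local Notation L2 := (Lfun mu 2%:E).
Local Notation ip := (ip mu).
Local Notation op K := (kernel_operator K mu).

Lemma L2_continuous (f : T -> R) : continuous f -> (f : borel T -> R) \in L2.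
Proof. by move=> cf; apply: L2_bounded_measurable; exact: continuous_bm. Qed.

Definition density (h : borel T -> R) (hL : h \in L2) : signed :=
  induced_charge (L2_integrable hL).

Definition point_charge (x : T) : signed :=
  charge_of_finite_measure [the probability (borel T) R of dirac (x : borel T)].

Lemma cintegral_point_charge x (f : T -> R) : continuous f ->
  cintegral (point_charge x) f = f x.
Proof.
move=> cf; rewrite cintegral_finite_measure; last exact: continuous_bm.
rewrite /Rintegral integral_dirac//=; first by rewrite indicE in_setT mul1r.
by apply/measurable_EFinP; exact: continuous_measurable.
Qed.

Lemma cintegral_densityE (h : borel T -> R) (hL : h \in L2) (f : T -> R) :
  continuous f -> cintegral (density hL) f = ip f h.
Proof. by move=> cf; rewrite cintegral_density//; exact: continuous_bm. Qed.

Section kernel.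
Variable K : T -> T -> R.
Hypothesis kK : is_kernel K.
Let symK := proj2 kK.
Let cKl := kernel_continuousl (proj1 kK).
Let cKr := kernel_continuousr (proj1 kK).

Lemma potential_density (h : borel T -> R) (hL : h \in L2) :
  (fun y => cintegral (density hL) (fun x => K x y)) = op K h.
Proof.
apply/funext => y; rewrite cintegral_densityE//.
by apply: eq_Rintegral => x _; rewrite symK.
Qed.

Lemma operator_continuous (h : borel T -> R) : h \in L2 ->
  continuous (op K h : T -> R).
Proof. by move=> hL; rewrite -(potential_density hL); exact: potential_continuous. Qed.

Lemma mutual_energy_density nu (h : borel T -> R) (hL : h \in L2) :
  mutual_energy K nu (density hL) = cintegral nu (op K h).
Proof. by rewrite /mutual_energy potential_density. Qed.

Lemma mutual_energy_point x nu : mutual_energy K (point_charge x) nu =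
  cintegral nu (K x).
Proof.
rewrite /mutual_energy cintegral_point_charge; last exact: potential_continuous.
by congr (cintegral nu _); apply/funext => y; rewrite symK.
Qed.

Lemma mutual_energy_points x y :
  mutual_energy K (point_charge x) (point_charge y) = K x y.
Proof. by rewrite mutual_energy_point cintegral_point_charge. Qed.

Lemma mutual_energy_densities (g h : borel T -> R) (gL : g \in L2) (hL : h \in L2) :
  mutual_energy K (density gL) (density hL) = ip (op K h) g.
Proof.
rewrite mutual_energy_density cintegral_densityE//.
exact: operator_continuous.
Qed.

Lemma operator_symmetric (g h : borel T -> R) : g \in L2 -> h \in L2 ->
  ip (op K g) h = ip g (op K h).
Proof.
move=> gL hL; rewrite -(mutual_energy_densities hL gL) mutual_energyC//.
by rewrite mutual_energy_densities ipC.
Qed.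

Lemma operatorB (g h : borel T -> R) x : g \in L2 -> h \in L2 ->
  op K (fun y => g y - h y) x = op K g x - op K h x.
Proof. by move=> gL hL; apply: (@ipBr R _ _ mu) => //; exact: L2_continuous. Qed.

Lemma operatorZ (a : R) (h : borel T -> R) x : h \in L2 ->
  op K (fun y => a * h y) x = a * op K h x.
Proof. by move=> hL; apply: (@ipZr R _ _ mu) => //; exact: L2_continuous. Qed.

Lemma operator_norm_le (M e : R) (h : borel T -> R) x : h \in L2 ->
  (forall x y, `|K x y| <= M) -> 0 <= e -> ip h h <= e ^+ 2 ->
  `|op K h x| <= M * e.
Proof.
move=> hL KM e0 he; have M0 : 0 <= M by exact: le_trans (KM x x).
have KxL : (K x : borel T -> R) \in L2 by exact: L2_continuous.
by apply: (ip_normP M0 e0 KxL hL) => //; exact: ip_bounded.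
Qed.

(** Positivity is required on all charges, so that the Cauchy-Schwarz inequality
    can mix densities with point masses: that is how a bound on the quadratic form
    in L^2 becomes a pointwise bound. *)
Definition psd := forall nu : signed, 0 <= energy K nu.

Lemma energy_cauchy_schwarz nu1 nu2 : psd ->
  mutual_energy K nu1 nu2 ^+ 2 <= energy K nu1 * energy K nu2.
Proof.
by move=> K0; apply: discriminant_le => // t; rewrite -energy_caddZ.
Qed.

Lemma psd_diag_ge0 x : psd -> 0 <= K x x.
Proof. by move=> /(_ (point_charge x)); rewrite [energy _ _]mutual_energy_points. Qed.

Lemma psd_form_ge0 (g : borel T -> R) : psd -> g \in L2 -> 0 <= ip (op K g) g.
Proof.
by move=> K0 gL; have := K0 (density gL); rewrite [energy _ _]mutual_energy_densities.
Qed.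

(** Cauchy-Schwarz between the point mass at x and the density of g. *)
Lemma psd_operator_le (g : borel T -> R) x : psd -> g \in L2 ->
  op K g x ^+ 2 <= K x x * ip (op K g) g.
Proof.
move=> K0 gL; have := energy_cauchy_schwarz (point_charge x) (density gL) K0.
rewrite mutual_energy_point cintegral_densityE//.
by rewrite [energy _ _]mutual_energy_points [energy _ _]mutual_energy_densities.
Qed.

Lemma psd_form_cauchy_schwarz (g h : borel T -> R) : psd -> g \in L2 -> h \in L2 ->
  ip (op K g) h ^+ 2 <= ip (op K g) g * ip (op K h) h.
Proof.
move=> K0 gL hL; have := energy_cauchy_schwarz (density hL) (density gL) K0.
by rewrite ![energy _ _]mutual_energy_densities mutual_energy_densities mulrC.
Qed.

(** Cauchy-Schwarz between the point mass at x and the difference of the point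
    masses at y and z. *)
Lemma psd_increment_le x y z : psd ->
  (K x y - K x z) ^+ 2 <= K x x * (K y y - 2 * K y z + K z z).
Proof.
move=> K0; have := energy_cauchy_schwarz (point_charge x)
  (cadd (point_charge y) (cscale (-1) (point_charge z))) K0.
rewrite energy_caddZ// mutual_energyDr// mutual_energyZr//.
rewrite ![energy _ _]mutual_energy_points !mutual_energy_points.
by rewrite mulN1r mulrN1 mulNr sqrrN expr1n mul1r.
Qed.

End kernel.
End operator.

(** * The top eigenvalue *)

Section uniform_cluster_point.
Context {R : realType} {T : pointedMetricType R}.
Hypothesis cT : compact [set: T].

(** The sets lie in a precompact set of functions by Ascoli's theorem, so the
    filter that they generate has a cluster point. Decreasing sets play the part of
    a sequence, and no subsequence has to be extracted. *)
Lemma uniform_cluster_point (W : nat -> set (T -> R)) (M : R) :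
  (forall n, W n !=set0) -> (forall m n, (m <= n)%N -> W n `<=` W m) ->
  (forall f x, W 0%N f -> `|f x| <= M) ->
  (forall x (e : R), 0 < e -> exists2 d : R, 0 < d &
     forall y, ball x d y -> forall f, W 0%N f -> `|f x - f y| < e) ->
  exists h : T -> R, forall n (e : R), 0 < e ->
    exists2 f, W n f & forall x, `|f x - h x| < e.
Proof.
move=> W0 Wdec WM Wequi.
have pW : pointwise_precompact (W 0%N) id.
  move=> x; apply: (@precompact_subset _ _ `[- M, M]%classic).
    by move=> _ [f Wf <-] /=; rewrite in_itv/= -ler_norml; exact: WM.
  by apply: compact_precompact; [exact: norm_hausdorff|exact: segment_compact].
have eW : equicontinuous (W 0%N) id.
  move=> x E; rewrite -entourage_ballE => -[e /= e0 eE].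
  have [d d0 dP] := Wequi x e e0.
  apply/nbhs_ballP; exists d => // y xy f Wf; apply: eE => /=.
  exact: dP xy _ Wf.
have hR : hausdorff_space R by exact: norm_hausdorff.
have := @pointwise_precompact_equicontinuous T R hR (W 0%N) pW eW.
rewrite precompactE => cW.
pose F := filter_from [set: nat] W.
have FF : ProperFilter F.
  apply: filter_from_proper => [|n _]; last exact: W0.
  apply: filter_from_filter => [|i j _ _]; first by exists 0%N.
  exists (maxn i j) => // f Wf; split; apply: Wdec Wf; rewrite ?leq_maxl//.
  exact: leq_maxr.
have [|h [_ hF]] := cW F FF.
  by exists 0%N => //; exact: (@subset_closure {family compact, T -> R}).
exists h => n e e0.
have nb : nbhs (h : {family compact, T -> R})
    [set g | forall y, setT y -> ball (h y) e (g y)].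
  exact: (@fam_nbhs _ _ _ _ [set xy | ball xy.1 e xy.2] h (entourage_ball _ (PosNum e0)) cT).
have [f [Wf hf]] := hF _ _ (ex_intro2 _ _ n I (@subset_refl _ (W n))) nb.
by exists f => // x; rewrite distrC; exact: hf.
Qed.

End uniform_cluster_point.

Section top_eigenvalue.
Context {R : realType} {T : pointedMetricType R}.
Hypothesis cT : compact [set: T].
Variable mu : probability (borel T) R.
Local Notation ip := (ip mu).
Local Notation op K := (kernel_operator K mu).

Definition form_bounds (K : T -> T -> R) := [set c : R | 0 <= c /\
  forall g : T -> R, continuous g -> ip (op K g) g <= c * ip g g].

(** For a positive definite kernel this is the norm of the operator. Taking the
    least bound of the form instead of the supremum of Rayleigh quotients avoids
    dividing by norms that may vanish. *)
Definition top_eigenvalue K := inf (form_bounds K).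

Section kernel.
Variable K : T -> T -> R.
Hypothesis kK : is_kernel K.

Let CL2 (f : T -> R) (cf : continuous f) := L2_continuous cT mu cf.
Let cop (g : T -> R) (cg : continuous g) := operator_continuous cT kK (CL2 cg).

Lemma form_le (M : R) (g : T -> R) : continuous g ->
  (forall x y, `|K x y| <= M) -> ip (op K g) g <= M * ip g g.
Proof.
move=> cg KM; have M0 : 0 <= M by exact: le_trans (KM point point).
pose e := Num.sqrt (ip g g).
have eE : ip g g = e ^+ 2 by rewrite sqr_sqrtr// ip_ge0.
have e0 : 0 <= e by exact: sqrtr_ge0.
apply: le_trans (ler_norm _) _; rewrite eE expr2 mulrA.
apply: ip_normP => //; rewrite ?mulr_ge0//; [exact/CL2/cop|exact: CL2| |].
  apply: ip_bounded => [|x]; first exact/CL2/cop.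
  by apply: (operator_norm_le cT kK) => //; [exact: CL2|rewrite eE].
by rewrite eE.
Qed.

Lemma form_bounds_bound (M : R) : (forall x y, `|K x y| <= M) -> form_bounds K M.
Proof.
move=> KM; split; first exact: le_trans (KM point point).
by move=> g cg; exact: form_le.
Qed.

Lemma form_bounds_neq0 : form_bounds K !=set0.
Proof.
have [M _ KM] := kernel_bounded cT (proj1 kK).
by exists M; exact: form_bounds_bound.
Qed.

Lemma top_eigenvalue_ge0 : 0 <= top_eigenvalue K.
Proof. by apply: lb_le_inf; [exact: form_bounds_neq0|move=> c []]. Qed.

Lemma top_eigenvalue_le c : form_bounds K c -> top_eigenvalue K <= c.
Proof. by apply: ge_inf; exists 0 => d []. Qed.

Lemma form_le_top_eigenvalue (g : T -> R) : continuous g ->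
  ip (op K g) g <= top_eigenvalue K * ip g g.
Proof.
move=> cg; have := ip_ge0 mu g; rewrite le_eqVlt => /predU1P[g0|g0].
  have [c [_ cP]] := form_bounds_neq0.
  by have := cP _ cg; rewrite -g0 !mulr0.
rewrite -ler_pdivrMr//; apply: lb_le_inf; first exact: form_bounds_neq0.
by move=> c [c0 cP]; rewrite ler_pdivrMr//; exact: cP.
Qed.

Lemma near_top_eigenvalue (s : R) : 0 < top_eigenvalue K -> 0 < s ->
  exists g : T -> R, [/\ continuous g, ip g g = 1 &
    top_eigenvalue K - s < ip (op K g) g].
Proof.
move=> L0 s0; pose c := Num.max 0 (top_eigenvalue K - s).
have cL : c < top_eigenvalue K by rewrite gt_max L0/= gtrBl.
have [g cg gc] : exists2 g : T -> R, continuous g & c * ip g g < ip (op K g) g.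
  apply: contrapT => H; suff /top_eigenvalue_le : form_bounds K c.
    by rewrite leNgt cL.
  split=> [|g cg]; first by rewrite le_max lexx.
  by rewrite leNgt; apply/negP => gc; apply: H; exists g.
have g0 : 0 < ip g g.
  rewrite lt_neqAle ip_ge0 andbT eq_sym; apply/eqP => g0.
  have := form_le_top_eigenvalue cg; rewrite g0 mulr0 => h.
  by move: gc; rewrite g0 mulr0 ltNge h.
pose a := (Num.sqrt (ip g g))^-1.
have aE : a ^+ 2 * ip g g = 1.
  by rewrite exprVn sqr_sqrtr ?ip_ge0// mulVf ?gt_eqF.
exists (fun x => a * g x); split; first exact: continuousZf.
  rewrite ipZl ?ipZr ?CL2//; last exact: continuousZf.
  by rewrite mulrA -expr2.
have -> : op K (fun x => a * g x) = (fun x => a * op K g x).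
  by apply/funext => x; rewrite (operatorZ cT kK)//; exact: CL2.
have cKg := cop cg.
rewrite ipZl ?ipZr ?CL2//; last exact: continuousZf.
rewrite mulrA -expr2; apply: le_lt_trans (_ : _ <= c) _.
  by rewrite le_max lexx orbT.
rewrite -[c]mulr1 -aE mulrCA ltr_pM2l//.
by rewrite exprn_gt0// invr_gt0 sqrtr_gt0.
Qed.

Hypothesis K0 : psd K.

(** Cauchy-Schwarz for the form, between g and Tg:
    |Tg|^4 <= form g * form (Tg) <= form g * L |Tg|^2. *)
Lemma ip_operator_le (g : T -> R) : continuous g ->
  ip (op K g) (op K g) <= top_eigenvalue K * ip (op K g) g.
Proof.
move=> cg; have cKg := cop cg; set L := top_eigenvalue K.
have := psd_form_cauchy_schwarz cT kK K0 (CL2 cg) (CL2 cKg).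
have := form_le_top_eigenvalue cKg; rewrite -/L.
have := psd_form_ge0 cT kK K0 (CL2 cg); have := ip_ge0 mu (op K g).
move: (ip (op K (op K g)) _) (ip (op K g) g) (ip (op K g) (op K g)).
move=> c b a a0 b0 ca abc.
have [->|a1] := eqVneq a 0; first by rewrite mulr_ge0// top_eigenvalue_ge0.
rewrite -(ler_pM2l (_ : 0 < a)); last by rewrite lt_neqAle eq_sym a1.
rewrite -expr2; apply: le_trans abc _.
by rewrite [leRHS](_ : _ = b * (L * a)) ?ler_wpM2l//; ring.
Qed.

(** The images Tg of the unit ball of L^2 are uniformly bounded and
    equicontinuous, so those of nearly maximising g have a uniform adherent
    point h. *)
Lemma approximate_eigenfunction : 0 < top_eigenvalue K ->
  exists h : T -> R, forall s : R, 0 < s -> exists g : T -> R,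
    [/\ continuous g, ip g g = 1, top_eigenvalue K - s ^+ 2 < ip (op K g) g &
        forall x, `|op K g x - h x| < s].
Proof.
move=> L0; set L := top_eigenvalue K.
have [M M0 KM] := kernel_bounded cT (proj1 kK).
pose W n := [set f | exists g : T -> R, [/\ continuous g, ip g g = 1,
  L - n.+1%:R^-1 < ip (op K g) g & f = op K g]].
have [|m n mn f [g [cg g1 gL ->]]|_ x [g [cg g1 _ ->]]|x e e0|h hP] :=
    @uniform_cluster_point R T cT W M.
- move=> n; have n0 : 0 < n.+1%:R^-1 :> R by rewrite invr_gt0.
  by have [g [cg g1 gL]] := near_top_eigenvalue L0 n0; exists (op K g); exists g.
- exists g; split => //; apply: le_lt_trans gL.
  by rewrite lerD2l lerN2 lef_pV2 ?posrE ?ltr0n// ler_nat.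
- rewrite -[M]mulr1; apply: (operator_norm_le cT kK) => //; first exact: CL2.
  by rewrite g1 expr1n.
- have e20 : 0 < e / 2 by rewrite divr_gt0.
  have [d d0 dP] := kernel_unif_continuous cT (proj1 kK) e20.
  exists d => // y xy _ [g [cg g1 _ ->]].
  have cKr := kernel_continuousr (proj1 kK).
  rewrite -[op K g x]/(ip (K x) g) -[op K g y]/(ip (K y) g) -ipBl ?CL2//.
  apply: (@le_lt_trans _ _ (e / 2 * 1)); last by rewrite mulr1; lra.
  have cB := continuousBf (cKr x) (cKr y).
  apply: ip_normP => //; [exact: ltW|exact: CL2|exact: CL2| |].
    by apply: ip_bounded => [|z]; [exact: CL2|exact: dP].
  by rewrite g1 expr1n.
exists h => s s0; have s20 : 0 < s ^+ 2 by rewrite exprn_gt0.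
have [k _ kP] := near_infty_natSinv_lt (PosNum s20).
have [_ [g [cg g1 gL ->]] gh] := hP k s s0.
exists g; split => //; apply: lt_trans gL.
by rewrite ltrD2l ltrN2; exact: (kP k (leqnn k)).
Qed.

(** A unit function g nearly maximising the form is nearly an eigenfunction, since
    |Tg - Lg|^2 <= L (L - form g); the uniform limit h of the functions Tg is then
    an eigenfunction. It is not zero, because the inner product of Tg and g stays
    close to L. *)
Lemma top_eigenfunction : 0 < top_eigenvalue K -> exists f : T -> R,
  [/\ continuous f, forall x, op K f x = top_eigenvalue K * f x & ip f f = 1].
Proof.
move=> L0; have [h hP] := approximate_eigenfunction L0.
set L := top_eigenvalue K in L0 hP *.
have [M M0 KM] := kernel_bounded cT (proj1 kK).
have ch : continuous h.
  apply/continuous_ballP => x e e0; have e30 : 0 < e / 3 by rewrite divr_gt0.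
  have [g [cg _ _ gh]] := hP _ e30.
  have /continuous_ballP/(_ x _ e30)[d d0 dP] := cop cg.
  exists d => // y /dP xy; have := gh x; have := gh y.
  have := ler_distD (op K g x) (h x) (h y); rewrite (distrC (h x) (op K g x)).
  have := ler_distD (op K g y) (op K g x) (h y); lra.
have eig x : op K h x = L * h x.
  apply/eqP; rewrite -subr_eq0 -normr_le0; apply/ler_addgt0Pl => e e0.
  rewrite addr0.
  (* (B - 1) s bounds the sum of the errors T(h - Tg), T(Tg - Lg), L(Tg - h). *)
  pose B := M + M * (L + 1) + L + 1.
  have ML : 0 <= M * (L + 1) by rewrite mulr_ge0// addr_ge0// ltW.
  have B1 : 0 < B by rewrite /B; lra.
  pose s := e / B; have s0 : 0 < s by rewrite divr_gt0.
  have sE : e = M * s + M * ((L + 1) * s) + L * s + s.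
    have -> : e = B * s by rewrite /s mulrC divfK// gt_eqF.
    by rewrite /B; ring.
  have [g [cg g1 gL gh]] := hP _ s0.
  have cKg := cop cg; have cLg := @continuousZf _ _ L _ cg.
  pose d y := op K g y - L * g y.
  have cd : continuous d by exact: continuousBf.
  have dd : ip d d <= ((L + 1) * s) ^+ 2.
    have -> : ip d d = ip (op K g) (op K g) - 2 * L * ip (op K g) g + L ^+ 2.
      rewrite /d ipBl ?ipBr ?CL2// ?ipZl ?ipZr ?CL2//.
      rewrite (ipC mu g) g1.
      by move: (ip (op K g) (op K g)) (ip (op K g) g) => u v; ring.
    have := ip_operator_le cg; move: gL; rewrite -/L.
    move: (ip (op K g) (op K g)) (ip (op K g) g) => u v vL uv.
    have Ls : L * (L - v) <= L * s ^+ 2 by rewrite ler_pM2l//; lra.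
    have s2 : 0 <= s ^+ 2 by exact: sqr_ge0.
    have L2s : 0 <= (L ^+ 2 + L + 1) * s ^+ 2.
      by rewrite mulr_ge0// !addr_ge0 ?sqr_ge0// ltW.
    rewrite [leRHS](_ : _ = L * s ^+ 2 + (L ^+ 2 + L + 1) * s ^+ 2); last by ring.
    apply: le_trans (_ : _ <= L * s ^+ 2) _; last by rewrite lerDl.
    apply: le_trans Ls; rewrite [leRHS](_ : _ = L * v - 2 * L * v + L ^+ 2); last by ring.
    by rewrite !lerD2r.
  have k1 : `|op K (fun y => h y - op K g y) x| <= M * s.
    have chg := continuousBf ch cKg.
    apply: (operator_norm_le cT kK) => //; [exact: CL2|exact: ltW|].
    by apply: ip_bounded => [|y]; [exact: CL2|rewrite distrC ltW].
  have k2 : `|op K d x| <= M * ((L + 1) * s).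
    apply: (operator_norm_le cT kK) => //; first exact: CL2.
    by rewrite mulr_ge0// ?addr_ge0// ltW.
  have k3 : `|L * (op K g x - h x)| <= L * s.
    by rewrite normrM gtr0_norm// ler_pM2l// ltW.
  rewrite (_ : op K h x - L * h x = op K (fun y => h y - op K g y) x + op K d x
    + L * (op K g x - h x)).
    apply: le_trans (ler_normD _ _) _; apply: le_trans (lerD (ler_normD _ _) k3) _.
    lra.
  rewrite /d !(operatorB cT kK) ?(operatorZ cT kK) ?CL2//.
  by move: (op K h x) (op K (op K g) x) (op K g x) => u v w; ring.
have h0 : 0 < ip h h.
  rewrite lt_neqAle ip_ge0 andbT eq_sym; apply/eqP => h0.
  pose s := Num.min 1 (L / 2).
  have s0 : 0 < s by rewrite lt_min ltr01/= divr_gt0.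
  have [s1 sL] : s <= 1 /\ s <= L / 2 by split; rewrite ge_min lexx ?orbT.
  have [g [cg g1 gL gh]] := hP _ s0; have cKg := cop cg.
  have chg := continuousBf cKg ch.
  have k1 : `|ip h g| <= 0 * 1.
    by apply: ip_normP; rewrite ?CL2// ?h0 ?g1 ?expr1n// expr0n.
  have k2 : `|ip (fun x => op K g x - h x) g| <= s * 1.
    apply: ip_normP; rewrite ?CL2// ?g1 ?expr1n//; first exact: ltW.
    by apply: ip_bounded => [|x]; [exact: CL2|exact: ltW].
  have ss : s ^+ 2 <= s by rewrite expr2 ler_piMl// ltW.
  move: k2; rewrite ipBl ?CL2// !mulr1; move: k1 gL.
  rewrite mul0r -/L; move: (ip (op K g) g) (ip h g) => u v.
  by rewrite !ler_norml => /andP[? ?] ? /andP[? ?]; lra.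
pose a := (Num.sqrt (ip h h))^-1.
exists (fun x => a * h x); split; first exact: continuousZf.
  by move=> x; rewrite (operatorZ cT kK) ?eig 1?mulrCA//; exact: CL2.
rewrite ipZl ?ipZr ?CL2//; last exact: continuousZf.
by rewrite mulrA -expr2 exprVn sqr_sqrtr ?ip_ge0// mulVf ?gt_eqF.
Qed.

End kernel.
End top_eigenvalue.

(** * Deflation *)

Section deflation.
Context {R : realType} {T : pointedMetricType R}.
Hypothesis cT : compact [set: T].
Variable mu : probability (borel T) R.
Local Notation signed := (charge (borel T) R).
Local Notation L2 := (Lfun mu 2%:E).
Local Notation ip := (ip mu).
Local Notation op K := (kernel_operator K mu).

(** When the top eigenvalue is 0 this may be the default function 0; deflation then
    changes nothing, and the sequence of residual kernels never has to stop. *)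
Definition top_eigenvector (K : T -> T -> R) : T -> R :=
  xget (fun=> 0) [set f : T -> R | [/\ continuous f,
    forall x, op K f x = top_eigenvalue mu K * f x & ip f f = 1]].

Definition deflate (K : T -> T -> R) x y :=
  K x y - top_eigenvalue mu K * top_eigenvector K x * top_eigenvector K y.

Section kernel.
Variable K : T -> T -> R.
Hypothesis kK : is_kernel K.
Hypothesis K0 : psd K.

Let L := top_eigenvalue mu K.
Let phi := top_eigenvector K.
Let CL2 (f : T -> R) (cf : continuous f) := L2_continuous cT mu cf.

Lemma top_eigenvectorP : [/\ continuous phi,
  forall x, op K phi x = L * phi x & L = 0 \/ ip phi phi = 1].
Proof.
rewrite /phi /top_eigenvector; case: xgetP => [f _ [cf fE f1]|nex].
  by split => //; right.
split; first exact: continuous_cst.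
  move=> x; rewrite mulr0 /kernel_operator; under eq_Rintegral do rewrite mulr0.
  by rewrite Rintegral_cst// mul0r.
left; apply/eqP; rewrite eq_le top_eigenvalue_ge0// andbT leNgt.
by apply/negP => /(top_eigenfunction cT kK K0)[f fP]; exact: nex fP.
Qed.

Let cphi : continuous phi. Proof. by have [] := top_eigenvectorP. Qed.

Lemma top_eigenvalue_ip : L * ip phi phi = L.
Proof.
by have [_ _ [->|->]] := top_eigenvectorP; rewrite ?mul0r ?mulr1.
Qed.

Lemma deflate_kernel : is_kernel (deflate K).
Proof.
have [cK sK] := kK; split=> [p|x y]; last by rewrite /deflate sK; ring.
apply: cvgB; first exact: cK.
apply: cvgM; last exact: (continuous_comp (@cvg_snd _ _ _ _ _) (@cphi _)).
apply: cvgM; first exact: cvg_cst.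
exact: (continuous_comp (@cvg_fst _ _ _ _ _) (@cphi _)).
Qed.

Lemma operator_deflate (h : borel T -> R) x : h \in L2 ->
  op (deflate K) h x = op K h x - L * phi x * ip phi h.
Proof.
move=> hL.
have cKr := kernel_continuousr (proj1 kK); have cKx : continuous (K x) := cKr x.
have cLphi : continuous (fun y => L * phi x * phi y) by exact: continuousZf.
rewrite -[op K h x]/(ip (K x) h) -ipZl ?(CL2 cphi)//.
by rewrite -ipBl ?(CL2 cKx) ?(CL2 cLphi).
Qed.

Lemma energy_deflate (nu : signed) :
  energy (deflate K) nu = energy K nu - L * cintegral nu phi ^+ 2.
Proof.
have BL := cintegral_bounded_linear cT nu; have [_ Z _] := BL.
have cK := proj1 kK.
have cp y : continuous (fun x => L * phi y * phi x) by exact: continuousZf.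
rewrite /energy.
rewrite (_ : (fun y => _) = (fun y => cintegral nu (fun x => K x y)
    - L * cintegral nu phi * phi y)).
  rewrite (bounded_linearB BL).
  - by rewrite Z//; ring.
  - exact: potential_continuous.
  - exact: continuousZf.
  - exact/continuousZf/continuousZf.
apply/funext => y; rewrite mulrAC -(Z _ phi cphi) -(bounded_linearB BL).
- by congr (cintegral nu _); apply/funext => x; rewrite /deflate mulrAC.
- exact: kernel_continuousl.
- exact: cp.
- exact/continuousZf/cp.
Qed.

(** Positivity survives deflation on every charge, not only on densities: the
    subtracted term is bounded by the Cauchy-Schwarz inequality between the
    charge and the density phi mu, because the potential of the latter is
    L phi. *)
Lemma deflate_psd : psd (deflate K).
Proof.
move=> nu; rewrite energy_deflate subr_ge0.
have [_ phiE [->|ip1]] := top_eigenvectorP; first by rewrite mul0r; exact: K0.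
have BL := cintegral_bounded_linear cT nu; have [_ Z _] := BL.
have := energy_cauchy_schwarz cT kK nu (density (CL2 cphi)) K0.
rewrite mutual_energy_density// [energy _ (density _)]mutual_energy_densities//.
have -> : op K phi = (fun x => L * phi x) by apply/funext => x; exact: phiE.
rewrite Z// ipZl ?CL2// ip1 mulr1 exprMn.
have [->|L0] := eqVneq L 0; first by rewrite mul0r => _; exact: K0.
have Lp : 0 < L by rewrite lt_neqAle eq_sym L0 top_eigenvalue_ge0.
by rewrite mulrC [L ^+ 2]expr2 mulrA ler_pM2r// mulrC.
Qed.

Lemma top_eigenvalue_deflate : top_eigenvalue mu (deflate K) <= L.
Proof.
apply: top_eigenvalue_le; split=> [|g cg]; first exact: top_eigenvalue_ge0.
apply: le_trans (form_le_top_eigenvalue cT mu kK cg).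
have cKg := operator_continuous cT kK (CL2 cg).
rewrite (_ : op (deflate K) g = (fun x => op K g x - L * ip phi g * phi x)).
  rewrite ipBl ?CL2//; last exact: continuousZf.
  rewrite ipZl ?CL2// gerBl -mulrA -expr2 mulr_ge0 ?sqr_ge0//.
  exact: top_eigenvalue_ge0.
by apply/funext => x; rewrite operator_deflate ?CL2// mulrAC.
Qed.

End kernel.

Section sequence.
Variable K : T -> T -> R.
Hypothesis kK : is_kernel K.
Hypothesis K0 : psd K.

Definition residual n := iter n deflate K.
Definition eigval n := top_eigenvalue mu (residual n).
Definition eigvec n := top_eigenvector (residual n).

Let CL2 (f : T -> R) (cf : continuous f) := L2_continuous cT mu cf.

Lemma residualS n : residual n.+1 = deflate (residual n). Proof. by []. Qed.

Lemma residual_kernel_psd n : is_kernel (residual n) /\ psd (residual n).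
Proof.
elim: n => [//|n [kn pn]]; rewrite residualS.
by split; [exact: deflate_kernel|exact: deflate_psd].
Qed.

Let kn n := (residual_kernel_psd n).1.
Let pn n := (residual_kernel_psd n).2.

Lemma eigvec_continuous n : continuous (eigvec n).
Proof. by have [] := top_eigenvectorP (kn n) (pn n). Qed.

Let cv := eigvec_continuous.

Lemma eigval_ge0 n : 0 <= eigval n.
Proof. exact (top_eigenvalue_ge0 cT mu (kn n)). Qed.

Lemma eigval_nonincreasing m n : (m <= n)%N -> eigval n <= eigval m.
Proof.
elim: n => [|n IH]; first by rewrite leqn0 => /eqP ->.
rewrite leq_eqVlt => /predU1P[-> //|/IH]; apply: le_trans.
exact (top_eigenvalue_deflate (kn n) (pn n)).
Qed.

Lemma residualE n x y : K x y =
  residual n x y + \sum_(j < n) eigval j * eigvec j x * eigvec j y.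
Proof.
elim: n => [|n IH]; first by rewrite big_ord0 addr0.
rewrite big_ord_recr residualS [LHS]IH /deflate -/(eigval n) -/(eigvec n) /=.
by move: (residual n x y) (eigval n) (\sum_(j < n) _) => u v w; ring.
Qed.

Lemma operator_residual n (h : borel T -> R) x : h \in L2 -> op K h x =
  op (residual n) h x + \sum_(j < n) eigval j * eigvec j x * ip (eigvec j) h.
Proof.
move=> hL; elim: n => [|n IH]; first by rewrite big_ord0 addr0.
rewrite big_ord_recr residualS [LHS]IH (operator_deflate (kn n) (pn n) x hL)/=.
rewrite -/(eigval n) -/(eigvec n).
by move: (op (residual n) h x) (ip _ _) (\sum_(j < n) _) => u v w; ring.
Qed.

Lemma eigval_ip n : eigval n * ip (eigvec n) (eigvec n) = eigval n.
Proof. exact (top_eigenvalue_ip (kn n) (pn n)). Qed.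

Lemma eigvec_normalized n : 0 < eigval n -> ip (eigvec n) (eigvec n) = 1.
Proof.
by move=> l0; apply: (mulfI (lt0r_neq0 l0)); rewrite eigval_ip mulr1.
Qed.

Lemma residual_eigvec n x : op (residual n) (eigvec n) x = eigval n * eigvec n x.
Proof. by have [_ -> _] := top_eigenvectorP (kn n) (pn n). Qed.

Lemma eigval_ip_orthogonal m n : (forall x, op (residual n) (eigvec m) x = 0) ->
  eigval n * ip (eigvec n) (eigvec m) = 0.
Proof.
move=> H; rewrite -ipZl ?CL2//.
rewrite (_ : (fun x => _) = op (residual n) (eigvec n)); last first.
  by apply/funext => x; rewrite residual_eigvec.
rewrite (operator_symmetric cT (kn n) (CL2 (@cv n)) (CL2 (@cv m))).
rewrite (_ : op (residual n) (eigvec m) = (fun=> 0)); last exact/funext.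
rewrite /ip; under eq_Rintegral do rewrite mulr0.
by rewrite Rintegral_cst// mul0r.
Qed.

(** Deflation along an eigenvector puts it in the kernel of the operator, and the
    later eigenvectors, being orthogonal to it, leave it there. *)
Lemma residual_eigvec_lt m n x : (m < n)%N -> op (residual n) (eigvec m) x = 0.
Proof.
elim: n x => [//|n IH] x; rewrite ltnS leq_eqVlt => /predU1P[->|mn].
  rewrite residualS (operator_deflate (kn n) (pn n) x (CL2 (@cv n))).
  rewrite -/(eigval n) -/(eigvec n) residual_eigvec.
  by rewrite mulrAC eigval_ip subrr.
rewrite residualS (operator_deflate (kn n) (pn n) x (CL2 (@cv m))).
rewrite -/(eigval n) -/(eigvec n) IH// mulrAC.
by rewrite eigval_ip_orthogonal ?mul0r ?subrr// => y; exact: IH.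
Qed.

Lemma eigvec_orthogonal m n : (m < n)%N -> 0 < eigval n ->
  ip (eigvec n) (eigvec m) = 0.
Proof.
move=> mn l0; apply: (mulfI (lt0r_neq0 l0)); rewrite mulr0.
by apply: eigval_ip_orthogonal => x; exact: residual_eigvec_lt.
Qed.

Lemma operator_eigvec n x : 0 < eigval n -> op K (eigvec n) x = eigval n * eigvec n x.
Proof.
move=> l0; rewrite (operator_residual n) ?CL2// residual_eigvec big1 ?addr0//.
by move=> j _; rewrite ipC eigvec_orthogonal// mulr0.
Qed.

Lemma diag_sum_le n x : \sum_(j < n) eigval j * eigvec j x ^+ 2 <= K x x.
Proof.
rewrite [leRHS](residualE n) -[leLHS]add0r lerD ?(psd_diag_ge0 cT (kn n) x (pn n))//.
by apply: ler_sum => j _; rewrite -mulrA -expr2.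
Qed.

Lemma residual_diag_le n x : residual n x x <= K x x.
Proof.
rewrite [leRHS](residualE n) lerDl; apply: sumr_ge0 => j _.
by rewrite -mulrA -expr2 mulr_ge0 ?sqr_ge0// eigval_ge0.
Qed.

Lemma energy_residual_le n (nu : signed) : energy (residual n) nu <= energy K nu.
Proof.
elim: n => [//|n IH]; apply: le_trans IH; rewrite residualS (energy_deflate (kn n) (pn n)).
by rewrite gerBl mulr_ge0 ?sqr_ge0//; exact: eigval_ge0.
Qed.

(** Integrating the diagonal bounds the trace, and a nonincreasing sequence
    with bounded partial sums is O(1/n). *)
Lemma eigval_le (M : R) n : (forall x y, `|K x y| <= M) ->
  eigval n <= M / n.+1%:R.
Proof.
move=> KM; rewrite ler_pdivlMr ?ltr0n//.
apply: (@le_trans _ _ (\sum_(j < n.+1) eigval j * ip (eigvec j) (eigvec j))).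
  rewrite [leLHS](_ : _ = \sum_(j < n.+1) eigval n); last first.
    by rewrite sumr_const card_ord mulr_natr.
  apply: ler_sum => j _; rewrite eigval_ip; apply: eigval_nonincreasing.
  by rewrite -ltnS.
have cF j : continuous (fun x => eigval j * eigvec j x : R).
  exact: continuousZf.
rewrite (_ : \sum_(_ < _) _ =
  \int[mu]_x (\sum_(j < n.+1) eigval j * eigvec j x ^+ 2)).
  have -> : M = \int[mu]_x (cst M x).
    by rewrite Rintegral_cst//= probability_setT mulr1.
  apply: le_Rintegral => //.
  - apply: (bounded_measurable_integrable mu); apply: (continuous_bm cT).
    apply: (continuous_sum (F := fun j x => eigval j * eigvec j x ^+ 2)) => j.
    by under eq_fun do rewrite expr2; exact/continuousZf/continuousMf.
  - exact: finite_measure_integrable_cst.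
  - move=> x _; apply: le_trans (diag_sum_le _ _) _.
    exact: le_trans (ler_norm _) (KM x x).
rewrite -(ip1r mu (fun x => \sum_(j < n.+1) eigval j * eigvec j x ^+ 2)).
rewrite (ip_suml n.+1 (F := fun j (x : borel T) => eigval j * eigvec j x ^+ 2)).
- apply: eq_bigr => j _.
  rewrite ipZl; [congr (_ * _)|apply: CL2|exact: L2_cst].
    by rewrite ip1r; apply: eq_Rintegral => x _; rewrite expr2.
  by under eq_fun do rewrite expr2; exact: continuousMf.
- move=> j; apply: CL2; under eq_fun do rewrite expr2.
  exact/continuousZf/continuousMf.
- exact: L2_cst.
Qed.

End sequence.
End deflation.

(** * Uniform convergence of the eigenexpansion *)

Section mercer.
Context {R : realType} {T : pointedMetricType R}.
Hypothesis cT : compact [set: T].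
Variable mu : probability (borel T) R.
Hypothesis mu_support : measure_support mu = [set: T].
Local Notation ip := (ip mu).
Local Notation op K := (kernel_operator K mu).

Let CL2 (f : T -> R) (cf : continuous f) := L2_continuous cT mu cf.
Let Cint (f : T -> R) (cf : continuous f) := L2_integrable (CL2 cf).

Lemma bump_integral_gt0 (z : T) (d : R) : 0 < d -> 0 < \int[mu]_x bump z d x.
Proof.
move=> d0; have d20 : 0 < d / 2 by rewrite divr_gt0.
pose B : set (borel T) := ball z (d / 2).
have mB : measurable B by apply: open_borel; exact: open_mdist_ball.
have muB : (0 < mu B)%E.
  have : measure_support mu z by rewrite mu_support.
  by apply; [exact: open_mdist_ball|exact: ballxx].
have bB := @bounded_measurable_indic _ _ R B mB.
apply: (@lt_le_trans _ _ (\int[mu]_x (d / 2 * \1_B x))).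
  rewrite RintegralZl//; last exact: bounded_measurable_integrable bB.
  rewrite Rintegral_indic// mulr_gt0// fine_gt0// muB/=.
  by rewrite ltey_eq fin_num_measure.
apply: le_Rintegral => //.
- exact: (bounded_measurable_integrable mu (bounded_measurableZ (d / 2) bB)).
- exact/Cint/continuous_bump.
move=> x _; rewrite indicE; have [xB|_] := boolP (x \in B); last first.
  by rewrite mulr0 bump_ge0.
have /set_mem : x \in B := xB; rewrite /B ballEmdist/= mulr1 => zx.
by rewrite /bump le_max; apply/orP; right; lra.
Qed.

Section kernel.
Variable K : T -> T -> R.
Hypothesis kK : is_kernel K.
Hypothesis K0 : psd K.

Local Notation res := (residual mu K).
Let kn n := (residual_kernel_psd cT mu kK K0 n).1.
Let pn n := (residual_kernel_psd cT mu kK K0 n).2.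

(** The increments of a positive definite kernel are controlled by the energy of
    a difference of two point masses, and deflation decreases energies: the
    modulus of continuity of K serves all residual kernels at once. *)
Lemma residual_equicontinuous (e : R) : 0 < e -> exists2 d : R, 0 < d &
  forall n x y z, ball y d z -> `|res n x y - res n x z| <= e.
Proof.
move=> e0; have [M M0 KM] := kernel_bounded cT (proj1 kK).
pose eta := e ^+ 2 / (2 * M + 1).
have eta0 : 0 < eta by rewrite divr_gt0 ?exprn_gt0//; lra.
have etaM : M * (2 * eta) <= e ^+ 2.
  have -> : e ^+ 2 = (2 * M + 1) * eta by rewrite /eta mulrC divfK//; lra.
  by rewrite mulrCA mulrA ler_pM2r//; lra.
have [d d0 dP] := kernel_unif_continuous cT (proj1 kK) eta0.
exists d => // n x y z yz; have symK := proj2 kK.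
rewrite -ler_sqr ?nnegrE//; last exact: ltW.
rewrite real_normK ?num_real//.
apply: le_trans (psd_increment_le cT (kn n) x y z (pn n)) _.
have Rd : res n y y - 2 * res n y z + res n z z <= 2 * eta.
  have := energy_residual_le cT mu kK K0 n
    (cadd (point_charge y) (cscale (-1) (point_charge z))).
  rewrite (energy_caddZ cT (kn n)) (energy_caddZ cT kK).
  rewrite (mutual_energy_points cT (kn n)) (mutual_energy_points cT kK).
  have E (K' : T -> T -> R) u : is_kernel K' -> energy K' (point_charge u) = K' u u.
    by move=> kK'; exact: (mutual_energy_points cT kK').
  rewrite !(E _ _ (kn n)) !(E _ _ kK) => h1.
  have := dP y z y yz; have := dP z y z (ball_sym yz).
  rewrite (symK z y); move: h1; move: (res n y y) (res n y z) (res n z z).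
  by move=> a b c h1; rewrite !ler_norml => /andP[? ?] /andP[? ?]; lra.
have Rx : res n x x <= M.
  apply: le_trans (residual_diag_le cT mu kK K0 n x) _.
  exact: le_trans (ler_norm _) (KM x x).
apply: le_trans etaM; apply: ler_pM => //; first exact: (psd_diag_ge0 cT (kn n) x (pn n)).
have := pn n (cadd (point_charge y) (cscale (-1) (point_charge z))).
rewrite (energy_caddZ cT (kn n)) (mutual_energy_points cT (kn n)).
have E u : energy (res n) (point_charge u) = res n u u.
  exact: (mutual_energy_points cT (kn n)).
by rewrite !E; move: (res n y y) (res n y z) (res n z z) => a b c; lra.
Qed.

Lemma residual_operator_le (M : R) (g : T -> R) n x : continuous g ->
  (forall x y, `|K x y| <= M) ->
  op (res n) g x ^+ 2 <= M * (M / n.+1%:R * ip g g).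
Proof.
move=> cg KM; apply: le_trans (psd_operator_le cT (kn n) x (pn n) (CL2 cg)) _.
apply: ler_pM.
- exact: (psd_diag_ge0 cT (kn n) x (pn n)).
- exact: (psd_form_ge0 cT (kn n) (pn n) (CL2 cg)).
- apply: le_trans (residual_diag_le cT mu kK K0 n x) _.
  exact: le_trans (ler_norm _) (KM x x).
- apply: le_trans (form_le_top_eigenvalue cT mu (kn n) cg) _.
  by rewrite ler_wpM2r ?ip_ge0//; exact: (eigval_le cT mu kK K0 n KM).
Qed.

(** Averaging the residual kernel against a bump at z gives its operator applied
    to that bump, which tends to 0 with the top eigenvalue; by equicontinuity the
    average is close to the value at z. *)
Lemma residual_cvg_at z (e : R) : 0 < e ->
  exists N, forall n, (N <= n)%N -> forall x, `|res n x z| <= e.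
Proof.
move=> e0; have [M M0 KM] := kernel_bounded cT (proj1 kK).
have e20 : 0 < e / 2 by rewrite divr_gt0.
have [d d0 dP] := residual_equicontinuous e20.
pose b := bump z d; have cb : continuous b by exact: continuous_bump.
pose I := \int[mu]_x b x; have I0 : 0 < I by exact: bump_integral_gt0.
pose C := M * M * ip b b.
have C0 : 0 <= C by rewrite !mulr_ge0 ?ip_ge0.
have t0 : 0 < (e / 2 * I) ^+ 2 by rewrite exprn_gt0// mulr_gt0.
exists (Num.bound (C / (e / 2 * I) ^+ 2)) => n Nn x.
have Tb : `|op (res n) b x| <= e / 2 * I.
  rewrite -ler_sqr ?nnegrE ?mulr_ge0//; [|exact: ltW..].
  rewrite real_normK ?num_real//.
  apply: le_trans (residual_operator_le n x cb KM) _.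
  rewrite (_ : M * _ = C / n.+1%:R); last by rewrite /C; ring.
  rewrite ler_pdivrMr ?ltr0n// -ler_pdivrMl// mulrC.
  have Ct : 0 <= C / (e / 2 * I) ^+ 2 by rewrite divr_ge0// ltW.
  apply: le_trans (ltW (archi_boundP Ct)) _.
  by rewrite ler_nat (leq_trans Nn).
have cR : continuous (res n x).
  have cRr := kernel_continuousr (proj1 (kn n)); exact: (cRr x).
have cRb := continuousMf cR cb.
have cB : continuous (fun y => (res n x z - res n x y) * b y).
  by apply: continuousMf => //; apply: continuousBf => //; exact: continuous_cst.
have E : res n x z * I = op (res n) b x + \int[mu]_y ((res n x z - res n x y) * b y).
  rewrite -[op _ _ _]/(\int[mu]_y (res n x y * b y)) -RintegralD//.
  - rewrite -RintegralZl//; last exact: Cint.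
    apply: eq_Rintegral => y _.
    by move: (res n x z) (res n x y) (b y) => u v w; ring.
  - exact: Cint.
  - exact: Cint.
have hB : `|\int[mu]_y ((res n x z - res n x y) * b y)| <= e / 2 * I.
  apply: le_trans (le_normr_Rintegral _ (Cint cB)) _ => //.
  rewrite -RintegralZl//; last exact: Cint.
  apply: le_Rintegral => //.
  - exact: (integrable_abse (Cint cB)).
  - exact/Cint/continuousZf.
  - move=> y _; have b0 : 0 <= b y by exact: bump_ge0.
    rewrite normrM (ger0_norm b0).
    have [->|by0] := eqVneq (b y) 0; first by rewrite !mulr0.
    rewrite ler_wpM2r//; apply: dP; rewrite ballEmdist/= -bump_gt0 -/(b y).
    by rewrite lt_neqAle eq_sym by0.
rewrite -(ler_pM2r I0) -{1}(gtr0_norm I0) -normrM E.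
apply: le_trans (ler_normD _ _) _; move: Tb hB.
have -> : e * I = e / 2 * I + e / 2 * I by rewrite -mulrDl -splitr.
exact: lerD.
Qed.

Lemma residual_cvg (e : R) : 0 < e ->
  exists N, forall n, (N <= n)%N -> forall x y, `|res n x y| <= e.
Proof.
move=> e0; have e20 : 0 < e / 2 by rewrite divr_gt0.
have [d d0 dP] := residual_equicontinuous e20.
have [s sP] := finite_net cT d0.
have [N NP] : exists N, forall n, (N <= n)%N -> forall z, z \in s ->
    forall x, `|res n x z| <= e / 2.
  elim: s {sP} => [|z s [N NP]]; first by exists 0%N.
  have [N' N'P] := residual_cvg_at z e20.
  exists (maxn N N') => n; rewrite geq_max => /andP[Nn N'n] u.
  rewrite inE => /predU1P[-> x|us x]; [exact: N'P|exact: NP].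
exists N => n Nn x y; have [z zs zy] := sP y.
have := NP n Nn z zs x; have := dP n x z y zy.
have := ler_normB (res n x z) (res n x z - res n x y); rewrite subKr.
by move: (res n x z) (res n x y) => u v; lra.
Qed.

End kernel.
End mercer.

(** * Completeness of the space of square-integrable functions *)

Section riesz_fischer.
Context {R : realType} d {T : measurableType d} (mu : probability T R).
Local Notation L2 := (Lfun mu 2%:E).
Local Notation ip := (ip mu).

Lemma L2_sqr_integral (h : T -> R) : measurable_fun setT h ->
  (\int[mu]_x (h x ^+ 2)%:E < +oo)%E -> h \in L2.
Proof.
move=> mh hoo; rewrite inE; apply/andP; split; rewrite inE//=.
rewrite /finite_norm unlock poweR_lty//; apply: le_lt_trans hoo.
rewrite le_eqVlt; apply/orP; left.
by apply/eqP/eq_integral => x _ /=; rewrite powR_mulrn// real_normK ?num_real.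
Qed.

Lemma ip_sqrE (h : T -> R) : h \in L2 -> (\int[mu]_x (h x ^+ 2)%:E)%E = (ip h h)%:E.
Proof.
move=> hL; rewrite /ip /Rintegral fineK.
  by apply: eq_integral => x _; rewrite expr2.
by apply: integrable_fin_num => //; exact: L2M_integrable.
Qed.

Lemma limn_einf_le (u : (\bar R)^nat) (e : \bar R) :
  (forall n, (u n <= e)%E) -> (limn_einf u <= e)%E.
Proof.
move=> ue; rewrite limn_einf_lim; apply: lime_le; first exact: is_cvg_einfs.
apply: nearW => n; apply: le_trans (ue n).
by apply: ereal_inf_lbound; exists n => /=.
Qed.

(** By monotone convergence the sum of the absolute steps has a finite integral,
    so it is finite almost everywhere. *)
Lemma ae_cvg_of_summable_steps (u : nat -> T -> R) : (forall n, u n \in L2) ->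
  (forall n, \int[mu]_x `|u n.+1 x - u n x| <= 1 / (2 ^ n.+1)%:R) ->
  {ae mu, forall x, cvgn (u ^~ x)}.
Proof.
move=> uL us; pose t n x := u n.+1 x - u n x.
have tL n : t n \in L2 by exact: L2B.
have mt n : measurable_fun setT (fun x => (`|t n x|)%:E).
  apply/measurable_EFinP; apply: measurableT_comp => //.
  exact: L2_measurable (tL n).
pose G x := (\sum_(n <oo) (`|t n x|)%:E)%E.
have GE : (\int[mu]_x G x <= 1)%E.
  rewrite integral_nneseries//.
  apply: le_trans (epsilon_trick0 xpredT ler01).
  apply: lee_nneseries => [n _ _|n _]; first by apply: integral_ge0 => x _; rewrite lee_fin.
  rewrite -[leLHS]fineK; first by rewrite lee_fin; exact: us.
  apply: integrable_fin_num => //.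
  exact: (integrable_abse (L2_integrable (tL n))).
have G0 x : (0 <= G x)%E by apply: nneseries_ge0 => n _ _; rewrite lee_fin.
have iG : mu.-integrable setT G.
  apply/integrableP; split.
    by apply: (ge0_emeasurable_sum (P := xpredT)) => // n x _ _; rewrite lee_fin.
  under eq_integral do rewrite gee0_abs//.
  exact: le_lt_trans GE (ltry _).
apply: filterS (integrable_ae measurableT iG) => x /(_ I) Gx.
have ct : cvgn (series (t ^~ x)).
  apply: normed_cvg; apply: nondecreasing_is_cvgn.
    apply/nondecreasing_seqP => n /=.
    by rewrite /series/= big_nat_recr//= lerDl.
  exists (fine (G x)) => _ [n _ <-]; rewrite -lee_fin fineK// /series/= -sumEFin.
  by apply: nneseries_lim_ge => k _ _; rewrite lee_fin.
rewrite (_ : u ^~ x = (fun n => series (t ^~ x) n + u 0%N x)).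
  by apply: is_cvgD => //; exact: is_cvg_cst.
apply/funext => n; rewrite (_ : series _ n = u n x - u 0%N x) ?subrK//.
elim: n => [|n IH]; first by rewrite /series/= big_nil subrr.
by rewrite /series/= big_nat_recr//= -/(series _ _) [X in X + _]IH /t addrC subrKA.
Qed.

(** A subsequence with geometrically small steps converges almost everywhere, and
    Fatou's lemma turns its pointwise limit into an L^2 limit of the whole
    sequence. *)
Lemma riesz_fischer (f : nat -> T -> R) : (forall n, f n \in L2) ->
  (forall e : R, 0 < e -> exists N, forall m n, (N <= m)%N -> (N <= n)%N ->
     ip (fun x => f m x - f n x) (fun x => f m x - f n x) <= e) ->
  exists2 g, g \in L2 & forall e : R, 0 < e -> exists N, forall n, (N <= n)%N ->
     ip (fun x => f n x - g x) (fun x => f n x - g x) <= e.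
Proof.
move=> fL cf; pose c n : R := 1 / (2 ^ n.+1)%:R.
have c0 n : 0 < c n by rewrite divr_gt0// ltr0n expn_gt0.
have /choice[N NP] : forall k, exists N, forall m n, (N <= m)%N -> (N <= n)%N ->
    ip (fun x => f m x - f n x) (fun x => f m x - f n x) <= c k ^+ 2.
  by move=> k; apply: cf; rewrite exprn_gt0.
pose s k := (\sum_(i < k.+1) (N i).+1)%N.
have sN k : (N k <= s k)%N by rewrite /s big_ord_recr/= addnS leqW ?leq_addl.
have sS k : (s k <= s k.+1)%N by rewrite /s [leqRHS]big_ord_recr/= leq_addr.
have sk k : (k <= s k)%N.
  elim: k => [//|k IH]; rewrite /s big_ord_recr/= -/(s k) addnS ltnS.
  exact: leq_trans IH (leq_addr _ _).
pose u k := f (s k); have uL k : u k \in L2 by exact: fL.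
have us k : \int[mu]_x `|u k.+1 x - u k x| <= 1 / (2 ^ k.+1)%:R.
  have dL : (fun x => `|u k.+1 x - u k x|) \in L2.
    apply: L2_sqr_integral.
      apply: measurableT_comp => //.
      exact: (L2_measurable (L2B (uL k.+1) (uL k))).
    under eq_integral do rewrite real_normK ?num_real//.
    by rewrite (ip_sqrE (L2B (uL k.+1) (uL k))) ltry.
  rewrite -ip1r; apply: le_trans (ler_norm _) _; rewrite -[leRHS]mulr1.
  apply: (ip_normP (ltW (c0 k)) ler01 dL (L2_cst mu 1)).
    rewrite /ip; under eq_Rintegral do rewrite -expr2 real_normK ?num_real// expr2.
    by apply: NP; [exact: leq_trans (sN k) (sS k)|exact: sN].
  by rewrite ip1r Rintegral_cst//= probability_setT mulr1 expr1n.
have := ae_cvg_of_summable_steps uL us.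
case=> A [mA A0 AP].
(* Cutting off the negligible set A makes the subsequence converge everywhere,
   which makes its limit measurable. *)
pose v k x := u k x * \1_(~` A) x; pose g x := limn (v ^~ x).
have vcvg x : v ^~ x @ \oo --> g x.
  have [xA|xA] := pselect (A x).
    rewrite /g (_ : v ^~ x = fun=> 0); last first.
      by apply/funext => k; rewrite /v indicE memNset ?mulr0//=; apply.
    exact: is_cvg_cst.
  rewrite /g (_ : v ^~ x = u ^~ x).
    by apply: contrapT => H; apply: xA; exact: AP.
  by apply/funext => k; rewrite /v indicE mem_set ?mulr1.
have mv k : measurable_fun setT (v k).
  apply: measurable_funM; first exact: L2_measurable.
  by apply: measurable_indic; exact: measurableC.
have mg : measurable_fun setT g.
  by apply: (measurable_fun_cvg mv) => x _; exact: vcvg.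
have bound (e : R) n k : (forall j, (k <= j)%N ->
      ip (fun x => f n x - u j x) (fun x => f n x - u j x) <= e) ->
    (\int[mu]_x ((f n x - g x) ^+ 2)%:E <= e%:E)%E.
  move=> H; pose F j x : \bar R := ((f n x - v (j + k)%N x) ^+ 2)%:E.
  have mF j : measurable_fun setT (F j).
    apply/measurable_EFinP/measurable_funX; apply: measurable_funB => //.
    exact: L2_measurable.
  rewrite (eq_integral (fun x => limn_einf (F ^~ x))); last first.
    move=> x _; apply/esym/(cvg_limn_einf_sup _).1.
    apply: cvg_EFin; first exact: nearW.
    apply: (@cvg_comp _ _ _ (fun j => f n x - v (j + k)%N x) (fun y : R => y ^+ 2)
       _ (nbhs (f n x - g x))); last exact: exprn_continuous.
    apply: cvgB; first exact: cvg_cst.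
    by have := vcvg x; rewrite -(cvg_shiftn k).
  apply: le_trans (fatou mu measurableT mF _) _.
    by move=> j x _; rewrite lee_fin sqr_ge0.
  apply: limn_einf_le => j.
  rewrite (_ : \int[mu]_x F j x = \int[mu]_x ((f n x - u (j + k)%N x) ^+ 2)%:E)%E.
    by rewrite (ip_sqrE (L2B (fL n) (uL _))) lee_fin; apply: H; exact: leq_addl.
  apply: ae_eq_integral => //.
    apply/measurable_EFinP/measurable_funX.
    exact: (L2_measurable (L2B (fL n) (uL _))).
  exists A; split => // x /= nx; apply: contrapT => xA; apply: nx => _.
  by rewrite /F /v indicE mem_set ?mulr1.
have approx (e : R) : 0 < e -> exists N0, forall n, (N0 <= n)%N ->
    (\int[mu]_x ((f n x - g x) ^+ 2)%:E <= e%:E)%E.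
  move=> e0; have [N0 N0P] := cf e e0; exists N0 => n Nn.
  apply: (bound e n N0) => j jN; apply: N0P => //.
  by apply: leq_trans jN _; exact: sk.
have fgL n : (\int[mu]_x ((f n x - g x) ^+ 2)%:E < +oo)%E ->
    (fun x => f n x - g x) \in L2.
  move=> H; apply: L2_sqr_integral => //; apply: measurable_funB => //.
  exact: L2_measurable.
have gL : g \in L2.
  have [N0 /(_ N0 (leqnn _)) H] := approx 1 ltr01.
  have := L2B (fL N0) (fgL N0 (le_lt_trans H (ltry _))).
  by under eq_fun do rewrite subKr.
exists g => // e e0; have [N0 N0P] := approx e e0; exists N0 => n Nn.
by rewrite -lee_fin -ip_sqrE; [exact: N0P|exact: L2B].
Qed.

End riesz_fischer.

(** * Total orthonormal families *)

Section uniform_convergence.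
Context {R : realType} {U : choiceType}.

Lemma uniform_cvgP (F : nat -> U -> R) (f : U -> R) :
  {uniform [set: U], F @ \oo --> f} <->
  forall e : R, 0 < e -> exists N, forall n, (N <= n)%N ->
    forall p, `|f p - F n p| < e.
Proof.
split=> [H e e0|H P].
  have : nbhs (f : {uniform U -> R}) [set g | forall p, setT p -> ball (f p) e (g p)].
    apply/uniform_nbhs; exists [set xy | ball xy.1 e xy.2].
    by split; [exact: (entourage_ball _ (PosNum e0))|].
  move/H => [N _ NP]; exists N => n Nn p.
  exact: (NP n Nn p I).
move=> /uniform_nbhs[E [+ EP]]; rewrite -entourage_ballE => -[e /= e0 eE].
have [N NP] := H e e0; exists N => // n /= Nn; apply: EP => p _; apply: eE.
exact: NP.
Qed.

End uniform_convergence.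

Section orthonormal_families.
Context {R : realType} {T : pointedMetricType R} (mu : probability (borel T) R).
Local Notation L2 := (Lfun mu 2%:E).
Local Notation ip := (ip mu).

Lemma Lnorm2_lt (h : borel T -> R) (e : R) : h \in L2 -> 0 < e ->
  ip h h < e ^+ 2 -> ('N[mu]_2%:E[EFin \o h] < e%:E)%E.
Proof.
move=> hL e0 he; rewrite unlock /Lnorm.
rewrite (eq_integral (fun x => (h x ^+ 2)%:E)); last first.
  by move=> x _ /=; rewrite powR_mulrn// real_normK ?num_real.
rewrite (ip_sqrE hL) poweR_EFin lte_fin powR12_sqrt ?ip_ge0//.
by rewrite -ltr_sqr ?nnegrE ?sqrtr_ge0 ?ltW// sqr_sqrtr ?ip_ge0.
Qed.

Lemma ip_sqrB (g h : borel T -> R) : g \in L2 -> h \in L2 ->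
  ip (fun x => g x - h x) (fun x => g x - h x) = ip g g - 2 * ip g h + ip h h.
Proof.
move=> gL hL; have ghL := L2B gL hL.
rewrite (ipBl gL hL ghL) (ipBr gL hL gL) (ipBr gL hL hL) (ipC mu h g).
by move: (ip g g) (ip g h) (ip h h) => u v w; ring.
Qed.

(** Riesz-Fischer turns the Bessel remainders of f into a limit orthogonal to the
    family; totality makes this limit vanish, so f is a limit of its Fourier sums. *)
Lemma total_orthonormal_dense (D : set nat) (phi : nat -> T -> R) :
  (forall j, D j -> (phi j : borel T -> R) \in L2) ->
  (forall i j, D i -> D j -> ip (phi i) (phi j) = (i == j)%:R) ->
  (forall h : borel T -> R, h \in L2 -> (forall j, D j -> ip h (phi j) = 0) ->
     ip h h = 0) ->
  forall f : borel T -> R, f \in L2 -> forall e : R, 0 < e ->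
    exists2 g, linear_span D phi g & ('N[mu]_2%:E[EFin \o (f \- g)%R] < e%:E)%E.
Proof.
move=> phiL phi1 total f fL e e0.
(* Functions outside D are replaced by 0, so that plain sums can be used. *)
pose psi j : borel T -> R := if j \in D then phi j else (fun=> 0).
have psiL j : psi j \in L2.
  by rewrite /psi; case: ifPn => [/set_mem/phiL//|_]; exact: L2_cst.
have ip0 h : ip h (fun=> 0) = 0.
  rewrite /ip; under eq_Rintegral do rewrite mulr0.
  by rewrite Rintegral_cst// mul0r.
have psi_ip i j : ip (psi i) (psi j) = ((i == j) && (i \in D))%:R.
  rewrite /psi; case: ifPn => [/set_mem iD|iD]; last by rewrite andbF ipC ip0.
  case: ifPn => [/set_mem jD|jD]; first by rewrite phi1// andbT.
  rewrite ip0 andbT; case: eqP => // ij; move: jD.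
  by rewrite -ij mem_set.
pose c j := ip f (psi j).
pose S n x := \sum_(j < n) c j * psi j x.
have cpL j : (fun x => c j * psi j x) \in L2 by exact: L2Z.
have SL n : S n \in L2 by exact: (L2_sum n cpL).
have SE n h : h \in L2 -> ip (S n) h = \sum_(j < n) c j * ip (psi j) h.
  move=> hL; rewrite /S (ip_suml n cpL hL).
  by apply: eq_bigr => j _; rewrite ipZl.
pose r n x := f x - S n x.
have rL n : r n \in L2 by exact: L2B.
have r_psi n i : (i < n)%N -> ip (r n) (psi i) = 0.
  move=> ilt; rewrite /r ipBl// SE// (bigD1 (Ordinal ilt))//= psi_ip eqxx/=.
  rewrite big1 ?addr0; last first.
    move=> j ji; rewrite psi_ip (_ : (j == i :> nat) = false) ?mulr0//.
    by apply/negbTE; apply: contraNneq ji => ji; apply/eqP/val_inj.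
  have [iD|iD] := boolP (i \in D); first by rewrite mulr1 subrr.
  by rewrite mulr0 subr0 /psi (negbTE iD) ip0.
have r_S n k : (k <= n)%N -> ip (r n) (S k) = 0.
  move=> kn; rewrite ipC SE// big1// => j _.
  by rewrite ipC r_psi ?mulr0// (leq_trans _ kn).
pose E n := ip (r n) (r n).
have rr m n : (m <= n)%N -> ip (fun x => r m x - r n x) (fun x => r m x - r n x)
    = E m - E n.
  move=> mn; have rnm : ip (r n) (r m) = E n.
    have rf k : (k <= n)%N -> ip (r n) (r k) = ip (r n) f.
      move=> kn; rewrite -[LHS]/(ip (r n) (fun x => f x - S k x)).
      by rewrite (ipBr fL (SL k) (rL n)) r_S// subr0.
    by rewrite /E !rf.
  rewrite (ip_sqrB (rL m) (rL n)) (ipC mu (r m) (r n)) rnm /E.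
  by move: (ip (r m) (r m)) (ip (r n) (r n)) => u v; ring.
have Edec m n : (m <= n)%N -> E n <= E m.
  by move=> mn; rewrite -subr_ge0 -rr//; exact: ip_ge0.
have rcauchy (e' : R) : 0 < e' -> exists N, forall m n, (N <= m)%N -> (N <= n)%N ->
    ip (fun x => r m x - r n x) (fun x => r m x - r n x) <= e'.
  move=> e'0; have hE : has_inf (range E).
    by split; [exists (E 0%N); exists 0%N|exists 0 => _ [n _ <-]; exact: ip_ge0].
  have [_ [N _ <-] EN] := inf_adherent e'0 hE.
  have key m n : (N <= m)%N -> (m <= n)%N ->
      ip (fun x => r m x - r n x) (fun x => r m x - r n x) <= e'.
    move=> Nm mn; rewrite rr//.
    have Einf : inf (range E) <= E n by apply: ge_inf; [case: hE|exists n].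
    have := Edec _ _ Nm; move: EN Einf.
    by move: (inf _) (E N) (E m) (E n) => a b u v; lra.
  exists N => m n Nm Nn; have [mn|nm] := leqP m n; first exact: key.
  have := key n m Nn (ltnW nm); congr (_ <= _).
  by apply: eq_Rintegral => x _; rewrite -[LHS]mulrNN !opprB.
have [g gL rg] := riesz_fischer rL rcauchy.
have g0 : ip g g = 0.
  apply: total => // i iD; have -> : phi i = psi i by rewrite /psi mem_set.
  apply/eqP; rewrite -normr_le0; apply/ler_addgt0Pl => e' e'0; rewrite addr0.
  have [N NP] := rg (e' ^+ 2) (exprn_gt0 2 e'0).
  have := NP (maxn N i.+1) (leq_maxl _ _).
  set n := maxn N i.+1 => rgn.
  have := ip_normP (ltW e'0) ler01 (L2B (rL n) gL) (psiL i) rgn _.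
  rewrite ipBl// r_psi ?leq_maxr// sub0r normrN mulr1; apply.
  by rewrite psi_ip eqxx mem_set// expr1n.
have e20 : 0 < e ^+ 2 / 4 by rewrite divr_gt0// exprn_gt0.
have [N /(_ N (leqnn _)) NP] := rg _ e20.
exists (fun x => \sum_(j < N | (j : nat) \in D) c j * phi j x).
  by exists N, c.
rewrite (_ : (f \- _) = r N); last first.
  apply/funext => x; rewrite /r /S /=; congr (_ - _).
  rewrite big_mkcond; apply: eq_bigr => j _; rewrite /psi.
  by case: ifP => // _; rewrite mulr0.
apply: Lnorm2_lt => //.
have gr0 : ip g (r N) = 0.
  have := ip_cauchy_schwarz gL (rL N); rewrite g0 mul0r => h.
  by apply/eqP; rewrite -sqrf_eq0 eq_le h sqr_ge0.
move: NP; rewrite (ip_sqrB (rL N) gL) (ipC mu (r N) g) gr0 g0.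
move: e20; move: (ip (r N) (r N)) (e ^+ 2) => u v; lra.
Qed.

End orthonormal_families.

(** * The eigenexpansion given by an invariant measure *)

Section eigenexpansion_of_invariant.
Context {R : realType} {T : pointedMetricType R}.
Hypothesis cT : compact [set: T].
Local Notation signed := (charge (borel T) R).
Variables (K : T -> T -> R) (mu : probability (borel T) R).
Hypothesis kK : is_kernel K.
Hypothesis mu_support : measure_support mu = [set: T].
Let m : signed := charge_of_finite_measure mu.
Hypothesis mu_invariant : forall x, potential K m x = energy K m.
Hypothesis K1 : cond_strictly_positive_definite K.
Local Notation L2 := (Lfun mu 2%:E).
Local Notation ip := (ip mu).
Local Notation op K := (kernel_operator K mu).

Let e0 := energy K m.

Definition centered_kernel x y := K x y - energy K m.
Local Notation K0 := centered_kernel.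

Let CL2 (f : T -> R) (cf : continuous f) := L2_continuous cT mu cf.

Lemma centered_is_kernel : is_kernel K0.
Proof.
have [cK sK] := kK; split=> [p|x y]; last by rewrite /K0 sK.
by apply: cvgB; [exact: cK|exact: cvg_cst].
Qed.

Lemma energy_centered (nu : signed) :
  energy K0 nu = energy K (cadd nu (cscale (- mass nu) m)).
Proof.
rewrite (energy_project cT kK mu_invariant).
by rewrite [LHS](energy_kernel_addC cT kK (- e0)) mulNr.
Qed.

Lemma centered_psd : psd K0.
Proof.
move=> nu; rewrite energy_centered; apply: K1.1; exact: neutral_project.
Qed.

Lemma centered_energy0 (nu : signed) : energy K0 nu = 0 ->
  eq_charge nu (cscale (mass nu) m).
Proof.
rewrite energy_centered => h0.
have := K1.2 _ (neutral_project cT mu nu) h0; rewrite !eq_charge_fine => H A mA.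
have := H A mA; rewrite fine_cadd_scaler// fine_cscale// fine_czero.
by move: (fine (nu A)) (mass nu) (fine (m A)) => u v w; lra.
Qed.

Lemma operator_centered (h : borel T -> R) x : h \in L2 ->
  op K h x = op K0 h x + e0 * \int[mu]_y h y.
Proof.
move=> hL; have cKr := kernel_continuousr (proj1 kK).
have KL : (K x : borel T -> R) \in L2 by exact/CL2/cKr.
have eL : (fun=> e0 : R) \in L2 by exact: L2_cst.
rewrite -[op K0 h x]/(ip (fun y => K x y - e0) h) (ipBl KL eL hL).
have -> : ip (fun=> e0) h = e0 * \int[mu]_y h y.
  by rewrite -RintegralZl//; exact: L2_integrable.
by rewrite -addrA addNr addr0.
Qed.

Lemma operator_one x : op K (fun=> 1) x = e0.
Proof.
rewrite /e0 -(mu_invariant x) /potential cintegral_finite_measure.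
  by apply: eq_Rintegral => y _; rewrite mulr1.
by apply: (continuous_bm cT); have cKr := kernel_continuousr (proj1 kK); exact: cKr.
Qed.

Lemma centered_operator_one x : op K0 (fun=> 1) x = 0.
Proof.
have := operator_centered x (L2_cst mu 1); rewrite operator_one.
by rewrite Rintegral_cst//= probability_setT !mulr1 => h; lra.
Qed.

Local Notation eval0 := (eigval mu K0).
Local Notation evec0 := (eigvec mu K0).
Let kK0 := centered_is_kernel.
Let pK0 := centered_psd.
Let cvec n : continuous (evec0 n) := @eigvec_continuous _ _ cT mu _ kK0 pK0 n.

(** Indices are shifted by one to make room for the constant function; the
    eigenvalues are nonincreasing, so the positive ones form an initial segment. *)
Definition expansion_index : set nat :=
  [set j | if j is j'.+1 then 0 < eval0 j' else True].
Definition expansion_value j := if j is j'.+1 then eval0 j' else energy K m.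
Definition expansion_function j := if j is j'.+1 then evec0 j' else (fun=> 1).

Local Notation D := expansion_index.
Local Notation lam := expansion_value.
Local Notation phi := expansion_function.

Lemma expansion_function_continuous j : continuous (phi j).
Proof. by case: j => [|j]; [exact: continuous_cst|exact: cvec]. Qed.

Let phiL j : (phi j : borel T -> R) \in L2.
Proof. by apply: CL2; exact: expansion_function_continuous. Qed.

(** The constant function is in the kernel of the centered operator, hence
    orthogonal to the eigenvectors of positive eigenvalue. *)
Lemma eigvec_integral0 j : 0 < eval0 j -> \int[mu]_x evec0 j x = 0.
Proof.
move=> l0; apply: (mulfI (lt0r_neq0 l0)); rewrite mulr0 -ip1r.
have oneL := L2_cst mu 1; have vL := phiL j.+1.
rewrite -(ipZl _ vL oneL).
rewrite (_ : (fun x => _) = op K0 (evec0 j)); last first.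
  by apply/funext => x; rewrite (operator_eigvec cT kK0 pK0).
rewrite (operator_symmetric cT kK0 vL oneL) /ip.
under eq_Rintegral do rewrite centered_operator_one mulr0.
by rewrite Rintegral_cst// mul0r.
Qed.

Lemma expansion_orthonormal i j : D i -> D j -> ip (phi i) (phi j) = (i == j)%:R.
Proof.
have ort i' j' : (i' < j')%N -> 0 < eval0 j' -> ip (evec0 j') (evec0 i') = 0.
  exact: (eigvec_orthogonal cT kK0 pK0).
case: i j => [|i] [|j] //= Di Dj.
- by rewrite ip1r Rintegral_cst//= probability_setT mulr1.
- by rewrite ipC ip1r eigvec_integral0.
- by rewrite ip1r eigvec_integral0.
rewrite eqSS; have [ij|ji|->] := ltngtP i j.
- by rewrite ipC ort.
- by rewrite ort.
- exact: (eigvec_normalized cT kK0 pK0).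
Qed.

Lemma expansion_eigen j x : D j -> op K (phi j) x = lam j * phi j x.
Proof.
case: j => [|j] Dj; first by rewrite operator_one mulr1.
rewrite (operator_centered x (phiL j.+1)) eigvec_integral0// mulr0 addr0.
exact: (operator_eigvec cT kK0 pK0).
Qed.

Lemma centered_residual_operator (h : borel T -> R) n x : h \in L2 ->
  (forall j, D j -> ip h (phi j) = 0) -> op K0 h x = op (residual mu K0 n) h x.
Proof.
move=> hL horth; rewrite (operator_residual cT kK0 pK0 n x hL) big1 ?addr0//.
move=> j _; have := eigval_ge0 cT mu kK0 pK0 j; rewrite le_eqVlt => /predU1P[<-|l0].
  by rewrite !mul0r.
by rewrite ipC [ip h _](horth j.+1) ?mulr0.
Qed.

(** A function orthogonal to the constants and to all eigenfunctions is
    annihilated by the integral operator, so its density has zero energy; strict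
    positivity forces the density to be a multiple of mu, hence null. *)
Lemma expansion_total (h : borel T -> R) : h \in L2 ->
  (forall j, D j -> ip h (phi j) = 0) -> ip h h = 0.
Proof.
move=> hL horth.
have op0 x : op K0 h x = 0.
  apply/eqP; rewrite -normr_le0; apply/ler_addgt0Pl => e e1; rewrite addr0.
  pose s := Num.sqrt (ip h h).
  have s0 : 0 <= s by exact: sqrtr_ge0.
  have sE : ip h h = s ^+ 2 by rewrite sqr_sqrtr ?ip_ge0.
  have es0 : 0 < e / (s + 1) by rewrite divr_gt0//; lra.
  have [N /(_ N (leqnn _)) NP] := residual_cvg cT mu_support kK0 pK0 es0.
  rewrite (centered_residual_operator N x hL horth).
  have kN := (residual_kernel_psd cT mu kK0 pK0 N).1.
  have shh : ip h h <= s ^+ 2 by rewrite sE.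
  apply: le_trans (operator_norm_le cT kN x hL NP s0 shh) _.
  by rewrite mulrAC ler_pdivrMr ?ler_pM2l//; lra.
have E0 : energy K0 (density hL) = 0.
  rewrite [energy _ _](mutual_energy_densities cT kK0 hL hL) /ip.
  under eq_Rintegral do rewrite op0 mul0r.
  by rewrite Rintegral_cst// mul0r.
have h1 : \int[mu]_x h x = 0 by rewrite -ip1r; exact: (horth 0%N).
have mass0 : mass (density hL) = 0 by exact: h1.
have hA (A : set (borel T)) : measurable A ->
    (\int[mu]_(x in A) (h x)%:E = \int[mu]_(x in A) cst 0 x)%E.
  move=> mA; rewrite [RHS]integral0.
  have := (eq_charge_fine _ _).1 (centered_energy0 E0) A mA.
  rewrite mass0 fine_cscale// mul0r => dA.
  have fA : density hL A \is a fin_num by exact: fin_num_measure.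
  by rewrite -[LHS]/(density hL A) -(fineK fA) dA.
have ih := L2_integrable hL.
have h0 : ae_eq mu setT (EFin \o h) (cst 0%E).
  by apply: integral_ae_eq => // A _ mA; exact: hA.
rewrite /ip /Rintegral (ae_eq_integral (cst 0%E))//.
- by rewrite integral0.
- by apply/measurable_EFinP; apply: measurable_funM; exact: (L2_measurable hL).
- by apply: filterS h0 => x H xT; have [/= ->] := H xT; rewrite mulr0.
Qed.

Lemma expansion_partial_sum n x y :
  \sum_(j < n.+1 | (j : nat) \in D) lam j * phi j x * phi j y =
  K x y - residual mu K0 n x y.
Proof.
rewrite big_mkcond big_ord_recl/= mem_set//= !mulr1.
have KE : K x y = K0 x y + e0 by rewrite /K0 subrK.
transitivity (e0 + \sum_(j < n) eval0 j * evec0 j x * evec0 j y); last first.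
  rewrite KE (residualE mu K0 n x y).
  by move: (residual mu K0 n x y) (\sum_(j < n) _) => u v; ring.
congr (_ + _); apply: eq_bigr => j _; rewrite /bump/=.
case: ifPn => // /negP jD.
have := eigval_ge0 cT mu kK0 pK0 j; rewrite le_eqVlt => /predU1P[<-|l0].
  by rewrite !mul0r.
by exfalso; apply: jD; rewrite mem_set.
Qed.

(** The terms are bounded by lambda_j (phi_j(x)^2 + phi_j(y)^2), whose sums are
    bounded by the diagonal of the centered kernel. *)
Lemma expansion_summable x y : summable D (fun j => (lam j * phi j x * phi j y)%:E).
Proof.
pose a j := lam j * phi j x * phi j y.
pose C := `|e0| + (K0 x x + K0 y y).
rewrite /summable (_ : D = [set j | j \in D]); last first.
  by apply/seteqP; split=> j /=; rewrite inE.
rewrite -(nneseries_esum (P := fun j => j \in D))//.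
apply: (@le_lt_trans _ _ C%:E); last exact: ltry.
apply: lime_le; first by apply: is_cvg_nneseries.
apply: nearW => n; rewrite (eq_bigr (fun j => (`|a j|)%:E))// sumEFin lee_fin.
apply: (@le_trans _ _ (\sum_(0 <= j < n.+1) `|a j|)).
  rewrite big_mkcond/= [leRHS]big_nat_recr//= -[leLHS]addr0 lerD//.
  by apply: ler_sum => j _; case: ifP.
rewrite big_mkord big_ord_recl/= /a/= !mulr1 lerD2l.
have dx := diag_sum_le cT mu kK0 pK0 n x.
have dy := diag_sum_le cT mu kK0 pK0 n y.
apply: le_trans (lerD dx dy); rewrite -big_split/=; apply: ler_sum => j _.
rewrite /bump/= -/(evec0 j) -mulrDr -mulrA normrM.
rewrite (ger0_norm (eigval_ge0 cT mu kK0 pK0 j)).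
apply: ler_wpM2l; first exact: (eigval_ge0 cT mu kK0 pK0 j).
move: (evec0 j x) (evec0 j y) => u v; rewrite normrM.
rewrite -[u ^+ 2]real_normK ?num_real// -[v ^+ 2]real_normK ?num_real//.
have := sqr_ge0 (`|u| - `|v|); have := sqr_ge0 `|u|; have := sqr_ge0 `|v|.
rewrite sqrrB; move: `|u| `|v| => s t; lra.
Qed.

Lemma eigenexpansion_exists : has_eigenexpansion K mu.
Proof.
exists D, lam, phi; split; first split.
- move=> i j; case: i => [_ _|i]; first exact: Logic.I.
  case: j => [|j] ij Dj; first by [].
  have Dj0 : 0 < eval0 j by exact: Dj.
  have nij : eval0 j <= eval0 i.
    by apply: (eigval_nonincreasing cT mu kK0 pK0); rewrite -ltnS.
  by change (is_true (0 < eval0 i)); exact: lt_le_trans Dj0 nij.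
- by move=> j _.
- exact: expansion_orthonormal.
- apply: total_orthonormal_dense => [j _| |].
  + exact: phiL.
  + exact: expansion_orthonormal.
  + exact: expansion_total.
- by move=> j Dj; apply: aeW => x; exact: expansion_eigen.
- by move=> j _ _; exact: expansion_function_continuous.
- by exists 1.
- by case=> [//|j] /=.
- apply/uniform_cvgP => e e1; have e20 : 0 < e / 2 by rewrite divr_gt0.
  have [N NP] := residual_cvg cT mu_support kK0 pK0 e20.
  exists N.+1 => -[//|n]; rewrite ltnS => Nn p.
  rewrite expansion_partial_sum subKr.
  by apply: le_lt_trans (NP n Nn p.1 p.2) _; lra.
- exact: expansion_summable.
Qed.

End eigenexpansion_of_invariant.

(** * Definiteness from an eigenexpansion *)

Section energy_of_eigenexpansion.
Context {R : realType} {T : pointedMetricType R}.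
Hypothesis cT : compact [set: T].
Local Notation signed := (charge (borel T) R).
Variables (K : T -> T -> R) (mu : probability (borel T) R).
Hypothesis kK : is_kernel K.
Variables (D : set nat) (lam : nat -> R) (phi : nat -> T -> R).
Hypothesis KD : is_eigenexpansion K mu D lam phi.

Lemma eigenexpansion_continuous j : D j -> continuous (phi j).
Proof.
case: j => [_|j Dj].
  have [c phi0] := exp_cst KD; rewrite (_ : phi 0%N = fun=> c).
    exact: continuous_cst.
  exact/funext.
by apply: (exp_continuous KD) => //; rewrite gt_eqF// (exp_gt0 KD).
Qed.

(** Uniform convergence lets the double integral be computed term by term. *)
Lemma energy_eigenexpansion (nu : signed) (e : R) : 0 < e ->
  exists N, forall n, (N <= n)%N ->
    `|energy K nu - \sum_(j < n | (j : nat) \in D) lam j * cintegral nu (phi j) ^+ 2|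
    <= e.
Proof.
move=> e0; have BL := cintegral_bounded_linear cT nu; have [LD LZ [C C0 LC]] := BL.
pose e' := e / (C * C + 1); have CC : 0 <= C * C by exact: mulr_ge0.
have e'0 : 0 < e' by rewrite divr_gt0//; lra.
have [N NP] := (uniform_cvgP _ _).1 (exp_uniform KD) e' e'0.
exists N => n Nn.
pose psi j : T -> R := if j \in D then phi j else (fun=> 0).
have cpsi j : continuous (psi j).
  rewrite /psi; case: ifPn => [/set_mem|_]; last exact: continuous_cst.
  exact: eigenexpansion_continuous.
pose S x y := \sum_(j < n) lam j * psi j x * psi j y.
have KS x y : `|K x y - S x y| <= e'.
  have := ltW (NP n Nn (x, y)); rewrite big_mkcond /S/=.
  congr (`|_ - _| <= _); apply: eq_bigr => j _; rewrite /psi.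
  by case: ifP => // _; rewrite mulr0.
have sumL (c : nat -> R) : continuous (fun x => \sum_(j < n) c j * psi j x) /\
    cintegral nu (fun x => \sum_(j < n) c j * psi j x) =
    \sum_(j < n) c j * cintegral nu (psi j).
  have cc j : continuous (fun x => c j * psi j x) by exact/continuousZf/cpsi.
  split; first exact: (continuous_sum (F := fun j x => c j * psi j x)).
  rewrite (bounded_linear_sum (F := fun j x => c j * psi j x) n BL)//.
  - by apply: eq_bigr => j _; rewrite LZ//; exact: cpsi.
  - exact: continuous_cst.
  - by move=> f g cf cg; exact: continuousDf.
have approxL (f g : T -> R) (E : R) : continuous f -> continuous g ->
    (forall x, `|f x - g x| <= E) -> `|cintegral nu f - cintegral nu g| <= C * E.
  move=> cf cg fg; rewrite -(bounded_linearB BL)//; last exact: continuousZf.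
  by apply: LC => //; exact: continuousBf.
have [cK _] := kK; have cKl := kernel_continuousl cK.
pose P y := \sum_(j < n) lam j * cintegral nu (psi j) * psi j y.
have [cP LP] := sumL (fun j => lam j * cintegral nu (psi j)).
have hP y : `|cintegral nu (fun x => K x y) - P y| <= C * e'.
  have [cs Ls] := sumL (fun j => lam j * psi j y).
  rewrite (_ : P y = cintegral nu (fun x => \sum_(j < n) lam j * psi j y * psi j x)).
    apply: approxL => // x; have := KS x y; rewrite /S.
    by congr (`|_ - _| <= _); apply: eq_bigr => j _; rewrite mulrAC.
  by rewrite Ls /P; apply: eq_bigr => j _; rewrite mulrAC.
have : `|energy K nu - cintegral nu P| <= C * (C * e').
  by apply: approxL => //; exact: (potential_continuous cT kK).
have -> : cintegral nu P =
    \sum_(j < n | (j : nat) \in D) lam j * cintegral nu (phi j) ^+ 2.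
  rewrite LP [RHS]big_mkcond; apply: eq_bigr => j _.
  rewrite /psi; case: ifP => _; first by rewrite -mulrA -expr2.
  by rewrite (cintegral_cst nu 0) mul0r mulr0.
move/le_trans; apply; rewrite mulrA.
have -> : e = C * C * e' + e' by rewrite /e'; field; lra.
by rewrite lerDl ltW.
Qed.

(** On a neutral charge the term of index 0 vanishes and the others have positive
    weights, so zero energy means that the charge annihilates every phi_j. *)
Lemma dense_cond_strictly : dense_in_continuous (linear_span D phi) ->
  cond_strictly_positive_definite K.
Proof.
move=> Kdense.
have [c phi0] := exp_cst KD.
have L0 (nu : signed) : mass nu = 0 -> cintegral nu (phi 0%N) = 0.
  move=> m0; rewrite (_ : phi 0%N = fun=> c); last exact/funext.
  by rewrite cintegral_cst m0 mulr0.
have term_ge0 (nu : signed) j : mass nu = 0 -> D j ->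
    0 <= lam j * cintegral nu (phi j) ^+ 2.
  move=> m0; case: j => [|j] Dj; first by rewrite L0// expr0n/= mulr0.
  by rewrite mulr_ge0 ?sqr_ge0// ltW// (exp_gt0 KD).
split=> nu /(neutralP cT) m0.
  apply/ler_addgt0Pl => e e0.
  have [N /(_ N (leqnn _))] := energy_eigenexpansion nu e0.
  have : 0 <= \sum_(j < N | (j : nat) \in D) lam j * cintegral nu (phi j) ^+ 2.
    by apply: sumr_ge0 => j /set_mem; exact: term_ge0.
  by rewrite ler_norml; move: (energy K nu) (\sum_(_ < _ | _) _) => u v h /andP[]; lra.
move=> E0.
have Lphi j : D j -> cintegral nu (phi j) = 0.
  move=> Dj; case: j Dj => [_|j Dj]; first exact: L0.
  have lj : 0 < lam j.+1 by exact: (exp_gt0 KD).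
  apply/eqP; rewrite -sqrf_eq0 -(mulrI_eq0 _ (lregP (lt0r_neq0 lj))).
  rewrite eq_le term_ge0// andbT; apply/ler_addgt0Pl => e e0; rewrite addr0.
  have [N /(_ (maxn N j.+2) (leq_maxl _ _))] := energy_eigenexpansion nu e0.
  rewrite E0 sub0r normrN; apply: le_trans; apply: le_trans (ler_norm _).
  have jN : (j.+1 < maxn N j.+2)%N by exact: leq_maxr.
  rewrite (bigD1 (Ordinal jN))/=; last exact: mem_set.
  by rewrite lerDl; apply: sumr_ge0 => i /andP[/set_mem Di _]; exact: term_ge0.
apply: (charge_eq0 cT) => f cf.
have BL := cintegral_bounded_linear cT nu; have [LD LZ [C C0 LC]] := BL.
apply/eqP; rewrite -normr_le0; apply/ler_addgt0Pl => e e0; rewrite addr0.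
have e'0 : 0 < e / (C + 1) by rewrite divr_gt0//; lra.
have [g [n [a gE]] fg] := Kdense f cf _ e'0.
pose F j : T -> R := if j \in D then (fun x => a j * phi j x) else (fun=> 0).
have cF j : continuous (F j).
  rewrite /F; case: ifPn => [/set_mem Dj|_]; last exact: continuous_cst.
  by apply: continuousZf; exact: eigenexpansion_continuous.
have gF : g = (fun x => \sum_(j < n) F j x).
  rewrite gE; apply/funext => x; rewrite big_mkcond; apply: eq_bigr => j _.
  by rewrite /F; case: ifP.
have cg : continuous g by rewrite gF; exact: continuous_sum.
have Lg : cintegral nu g = 0.
  rewrite gF (bounded_linear_sum (F := F) n BL).
  - rewrite big1// => j _; rewrite /F; case: ifPn => [/set_mem Dj|_].
      by rewrite LZ ?Lphi ?mulr0//; exact: eigenexpansion_continuous.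
    by rewrite (cintegral_cst nu 0) mul0r.
  - exact: continuous_cst.
  - by move=> u v cu cv; exact: continuousDf.
  - exact: cF.
rewrite -[cintegral nu f]subr0 -Lg -(bounded_linearB BL)//; last exact: continuousZf.
apply: le_trans (LC _ (e / (C + 1)) _ _) _.
- exact: continuousBf.
- by move=> x; exact: ltW.
- have -> : e = C * (e / (C + 1)) + e / (C + 1) by field; lra.
  by rewrite [X in C * (X / _)](_ : _ = e) ?lerDl ?ltW//; field; lra.
Qed.

End energy_of_eigenexpansion.

(** * The theorem *)

Theorem theorem4p3 (R : realType) (Omega : pointedMetricType R)
    (Omega_compact : compact [set: Omega])
    (K : Omega -> Omega -> R) (K_kernel : is_kernel K)
    (mu : probability (borel Omega) R)
    (mu_invariant : forall x,
       potential K (charge_of_finite_measure mu) x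
       = energy K (charge_of_finite_measure mu)) :
  let c1 := cond_strictly_positive_definite K in
  let c2 := strictly_positive_definite_mod_cst K in
  let c3 :=
    is_unique_minimizer K signed_prob_measures (charge_of_finite_measure mu) in
  let c4 := strictly_convex_energy_on prob_measures K in
  let c4' := strictly_convex_energy_on signed_prob_measures K in
  let c5 := has_eigenexpansion K mu in
  [/\ c1 <-> c2, c1 <-> c3, c1 <-> c4 & c4 <-> c4']
  /\ (measure_support mu = [set: Omega] ->
      [/\ c1 -> c5, c2 -> c5 & c3 -> c5]
      /\ forall (D : set nat) (lambda : nat -> R) (phi : nat -> Omega -> R),
           is_eigenexpansion K mu D lambda phi ->
           dense_in_continuous (linear_span D phi) ->
           [/\ c1, c2 & c3]).
Proof.
move=> c1 c2 c3 c4 c4' c5.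
have cT := Omega_compact; have kK := K_kernel.
have c12 : c1 <-> c2.
  by split; [exact: cond_strictly_mod_cst|exact: mod_cst_cond_strictly].
have c13 : c1 <-> c3.
  by split; [exact: cond_strictly_minimizer|exact: minimizer_cond_strictly].
have c14' : c1 -> c4' by exact: cond_strictly_convex.
have c4'4 : c4' -> c4.
  by apply: strictly_convex_subset; exact: prob_signed_prob.
have c41 : c4 -> c1 by exact: (convex_cond_strictly cT kK mu).
have c15 : measure_support mu = [set: Omega] -> c1 -> c5.
  by move=> h1 h2; exact: (eigenexpansion_exists cT kK h1 mu_invariant h2).
have c51 D lambda phi : is_eigenexpansion K mu D lambda phi ->
    dense_in_continuous (linear_span D phi) -> c1.
  by move=> h1 h2; exact: (dense_cond_strictly cT kK h1 h2).
clearbody c1 c2 c3 c4 c4' c5; split; first by split; tauto.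
move=> /c15 {}c15; split; first by split; tauto.
by move=> D lambda phi KD phi_dense; have h1 := c51 _ _ _ KD phi_dense; split; tauto.
Qed.
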